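(* Let $A\subset\mathbb{H}$ be a closed subset of the Heisenberg group whose Hausdorff $3$-measure with respect to the Carnot--Carathéodory metric $d_{cc}$ is zero. Then $\mathbb{H}\setminus A$, equipped with the restriction of $d_{cc}$, is quasiconvex.
   Context: The Heisenberg group $\mathbb{H}$ is $\mathbb{R}^3$ with the group law $(x,y,t)*(x',y',t') = (x+x',\,y+y',\,t+t'+2(x'y-xy'))$. It carries the left-invariant vector fields $X=\partial_x+2y\,\partial_t$ and $Y=\partial_y-2x\,\partial_t$. An absolutely continuous curve $\gamma$ in $\mathbb{H}$ is horizontal if for almost every $s$ one has $\gamma'(s)=a(s)X+b(s)Y$ (vector fields evaluated at $\gamma(s)$) for some functions $a,b$; its cc-length is $\ell_{cc}(\gamma)=\int\sqrt{a(s)^2+b(s)^2}\,ds$. The Carnot--Carathéodory distance $d_{cc}(p,q)$ is the infimum of the cc-lengths of all horizontal curves joining $p$ to $q$. The topology of $(\mathbb{H},d_{cc})$ is the Euclidean topology of $\mathbb{R}^3$. A metric space $(Z,d)$ is $c$-quasiconvex ($c\ge 1$) if every pair of points $u,v\in Z$ can be joined by a rectifiable curve in $Z$ whose length is at most $c\,d(u,v)$; it is quasiconvex if it is $c$-quasiconvex for some $c\ge1$. *)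

(* Defs.v *)
From HB Require Import structures.
From mathcomp Require Import all_boot all_order all_algebra.
From mathcomp Require Import all_classical all_reals all_analysis.
From mathcomp Require Import ring.
Set Implicit Arguments.
Unset Strict Implicit.
Unset Printing Implicit Defensive.
Import Order.TTheory GRing.Theory Num.Theory.
Import numFieldNormedType.Exports.
Local Open Scope classical_set_scope.
Local Open Scope ring_scope.

Section MetricNotions.
Context (R : realType) (T : Type).

(* Distances take values in [0, +oo], so that d_cc, an infimum over a set of
   curves, can be used without first proving it finite. *)
Implicit Types (d : T -> T -> \bar R) (U Z : set T) (g : R -> T).

(* The join with 0 only matters for the empty set. *)
Definition diameter d U : \bar R :=
  ereal_sup ([set 0%E] `|` [set x | exists u v, [/\ U u, U v & x = d u v]]).

Definition hausdorff_premeasure d (s delta : R) U : \bar R :=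
  ereal_inf [set (\sum_(0 <= i <oo) (diameter d (C i) `^ s))%E | C in
    [set C : nat -> set T |
      U `<=` \bigcup_i C i /\ forall i, (diameter d (C i) <= delta%:E)%E]].

(* Meant for s > 0, so that empty sets in a cover contribute 0.  No
   normalizing constant is put in front of the sums. *)
Definition hausdorff_measure d (s : R) U : \bar R :=
  ereal_sup [set hausdorff_premeasure d s delta U | delta in
    [set delta | 0 < delta]].

(* A curve is given by a total function on R of which only the values on
   [t0, t1] matter. *)
Definition curve_continuous d (t0 t1 : R) g : Prop :=
  forall s, s \in `[t0, t1] -> forall e : R, 0 < e ->
    exists2 delta : R, 0 < delta &
      forall t, t \in `[t0, t1] -> `|t - s| < delta -> (d (g s) (g t) < e%:E)%E.

Definition curve_length d (t0 t1 : R) g : \bar R :=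
  ereal_sup [set (\sum_(0 <= i < size r)
                    d (g (nth t0 (t0 :: r) i)) (g (nth t0 (t0 :: r) i.+1)))%E
            | r in itv_partition t0 t1].

Definition quasiconvex_with (c : R) d Z : Prop :=
  forall u v, Z u -> Z v ->
    exists t0 t1 : R, exists g : R -> T,
      [/\ t0 <= t1, g t0 = u, g t1 = v &
          [/\ forall t, t \in `[t0, t1] -> Z (g t),
              curve_continuous d t0 t1 g,
              (curve_length d t0 t1 g < +oo)%E &
              (curve_length d t0 t1 g <= c%:E * d u v)%E]].

Definition quasiconvex d Z : Prop :=
  exists2 c : R, 1 <= c & quasiconvex_with c d Z.

End MetricNotions.

(* Two intervals [l i, r i] may share an endpoint: only the open intervals are
   required to be disjoint. *)
Definition absolutely_continuous (R : realType) (V : normedModType R)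
    (t0 t1 : R) (f : R -> V) : Prop :=
  forall e : R, 0 < e -> exists2 delta : R, 0 < delta &
    forall (n : nat) (l r : 'I_n -> R),
      (forall i, [/\ t0 <= l i, l i <= r i & r i <= t1]) ->
      trivIset setT (fun i => `]l i, r i[%classic) ->
      \sum_(i < n) (r i - l i) < delta ->
      \sum_(i < n) `|f (r i) - f (l i)| < e.

(* R^3 with its product topology and its sup norm. *)
Notation heisenberg R := (R^o * R^o * R^o)%type.

Section Heisenberg.
Context (R : realType).
Implicit Types (p q : heisenberg R) (g : R -> heisenberg R).

Definition hmul p q : heisenberg R :=
  let: (x, y, t) := p in let: (x', y', t') := q in
  (x + x', y + y', t + t' + 2 * (x' * y - x * y')).

Definition hX p : heisenberg R := let: (x, y, t) := p in (1, 0, 2 * y).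
Definition hY p : heisenberg R := let: (x, y, t) := p in (0, 1, - (2 * x)).

Lemma hmul_hX p (e : R) : hmul p (e, 0, 0) = p + e *: hX p.
Proof.
case: p => [[x y] t]; apply/eqP; rewrite !xpair_eqE /=; apply/andP; split.
  by apply/andP; split; apply/eqP; rewrite /= /GRing.scale /=; ring.
by apply/eqP; rewrite /= /GRing.scale /=; ring.
Qed.

Lemma hmul_hY p (e : R) : hmul p (0, e, 0) = p + e *: hY p.
Proof.
case: p => [[x y] t]; apply/eqP; rewrite !xpair_eqE /=; apply/andP; split.
  by apply/andP; split; apply/eqP; rewrite /= /GRing.scale /=; ring.
by apply/eqP; rewrite /= /GRing.scale /=; ring.
Qed.

(* The curve g on [t0, t1] is horizontal, with coefficients a and b. *)
Definition horizontal_with (t0 t1 : R) g (a b : R -> R) : Prop :=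
  absolutely_continuous t0 t1 g /\
  {ae (@lebesgue_measure R), forall s, s \in `]t0, t1[ ->
    is_derive s 1 g (a s *: hX (g s) + b s *: hY (g s))}.

(* No measurability is asked of a and b: along a horizontal curve they agree
   almost everywhere with the derivatives of the first two coordinates. *)
Definition cc_length (t0 t1 : R) (a b : R -> R) : \bar R :=
  (\int[@lebesgue_measure R]_(s in `[t0, t1])
     (Num.sqrt (a s ^+ 2 + b s ^+ 2))%:E)%E.

Definition dcc p q : \bar R :=
  ereal_inf [set ell | exists t0 t1 g a b,
    [/\ t0 <= t1, horizontal_with t0 t1 g a b, g t0 = p, g t1 = q &
        ell = cc_length t0 t1 a b]].

End Heisenberg.

(* Main.v *)
(* Along a left coset of exp(RX) the pair (y, t - 2xy) is constant, and a set of
   dcc-diameter d meets only cosets whose pairs lie in a sheared strip of area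
   O(d^3); likewise for Y.  Hence, if H^3(A) = 0, the cosets meeting A are
   negligible.  Given u and v off A, write v = u * w with w a product of six
   horizontal elements exp(sX), exp(sY) of total length at most 7 dcc(u, v).  Moving
   u to u' = u + (r, r, t), each of the six segments of the path from u' to u' * w
   lies on a coset which, for almost every (r, t), avoids A.  As A is closed, u can
   be joined to u', and u' * w to v, by short words inside small balls avoiding A.
   The lower bound dcc(p, q) >= max(|x' - x|, |y' - y|, sqrt(|tau|) / 2), where tau
   is the last coordinate of p^-1 * q, is needed both for the length of w and for
   the strips; it comes from comparing a coordinate along a horizontal curve with
   the primitive of the speed sqrt(a^2 + b^2). *)

Require Import Defs.
From mathcomp Require Import all_boot all_order all_algebra.
From mathcomp Require Import all_classical all_reals all_analysis.
From mathcomp Require Import measurable_realfun ring lra.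
Set Implicit Arguments.
Unset Strict Implicit.
Unset Printing Implicit Defensive.
Import Order.TTheory GRing.Theory Num.Theory.
Import numFieldNormedType.Exports.
Local Open Scope classical_set_scope.
Local Open Scope ring_scope.

(** * Increments of absolutely continuous functions *)

(** The supremum of the points satisfying [P] may fail to satisfy [P] itself; this is why a step may
    jump over [s], from any nearby [l] on its left to any nearby [r] on its right. Applied at the
    supremum, the step passes beyond it unless [t1] is reached. *)
Lemma real_interval_induction (R : realType) (P : R -> Prop) (t0 t1 : R) :
  t0 <= t1 -> P t0 ->
  (forall s, t0 <= s <= t1 -> exists2 rho : R, 0 < rho &
     forall l r, t0 <= l -> l <= s -> s <= r -> r <= t1 ->
       s - rho < l -> r < s + rho -> P l -> P r) ->
  P t1.
Proof.
move=> t01 P0 step.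
pose S := [set s | t0 <= s <= t1 /\ P s].
have S0 : S t0 by split; rewrite // lexx.
have Sub : has_ubound S by exists t1 => s [/andP[]].
have Snb : has_sup S by split => //; exists t0.
have m0 : t0 <= sup S by apply: ub_le_sup.
have m1 : sup S <= t1 by apply: ge_sup; [exists t0|move=> s [/andP[]]].
have [|rho rho0 H] := step (sup S); first by rewrite m0.
have [l [/andP[l0 l1] Pl] lm] := sup_adherent rho0 Snb.
have lS : l <= sup S by apply: ub_le_sup => //; split => //; rewrite l0.
pose r := Num.min t1 (sup S + rho / 2).
have Sr : sup S <= r by rewrite /r le_min m1 lerDl; lra.
have rt : r <= t1 by rewrite /r ge_min lexx.
have Pr : P r.
  apply: (H l) => //.
  by rewrite /r gt_min; apply/orP; right; rewrite ltrD2l; lra.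
have rS : r <= sup S.
  by apply: ub_le_sup => //; split => //; rewrite rt andbT (le_trans m0).
have : r = t1 \/ r = sup S + rho / 2 by rewrite /r /Num.min; case: ifP; [left|right].
by case=> [<-//|e]; move: rS; rewrite e; lra.
Qed.

Lemma sum_itv_length_le (R : realType) (n : nat) (l r : 'I_n -> R) (U : set R) :
  open U -> (forall i, l i <= r i) -> (forall i, `]l i, r i[ `<=` U) ->
  trivIset setT (fun i => `]l i, r i[%classic) ->
  ((\sum_(i < n) (r i - l i))%:E <= (@lebesgue_measure R) U)%E.
Proof.
move=> oU lr sU tI.
have -> : ((\sum_(i < n) (r i - l i))%:E =
   (\sum_(i < n) (@lebesgue_measure R) `]l i, r i[%classic))%E.
  rewrite -sumEFin; apply: eq_bigr => i _.
  rewrite lebesgue_measure_itv/= lte_fin.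
  have := lr i; rewrite le_eqVlt => /orP[/eqP ->|->]; last by rewrite EFinB.
  by rewrite ltxx subrr.
rewrite -measure_semi_additive_ord//=; last first.
  by apply: bigsetU_measurable => i _; exact: measurable_itv.
apply: le_measure; rewrite ?inE.
- by apply: bigsetU_measurable => i _; exact: measurable_itv.
- exact: open_measurable.
by elim/big_ind : _ => // A B AU BU; rewrite subUset.
Qed.

(* Off [N] the increments of [f] over short intervals are controlled by [G];
   intervals tagged by a point of [N] lie in an open set of small measure,
   where absolute continuity controls them. *)
Lemma absolutely_continuous_increment_le (R : realType) (t0 t1 : R)
    (f G : R -> R) (N : set R) :
  t0 <= t1 -> absolutely_continuous (V := R^o) t0 t1 f ->
  {homo G : x y / x <= y} -> (@lebesgue_measure R).-negligible N ->
  (forall s, t0 <= s <= t1 -> ~ N s -> forall e : R, 0 < e ->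
     exists2 rho : R, 0 < rho &
     forall l r, t0 <= l -> l <= s -> s <= r -> r <= t1 ->
       s - rho < l -> r < s + rho -> f r - f l <= G r - G l + e * (r - l)) ->
  f t1 - f t0 <= G t1 - G t0.
Proof.
move=> t01 acf Gh [M [mM M0 NM]] H.
suff K (e : R) : 0 < e -> f t1 - f t0 <= G t1 - G t0 + e * (t1 - t0) + e.
  apply/ler_addgt0Pr => e e0.
  have p : 0 < t1 - t0 + 1 by lra.
  have := K (e / (t1 - t0 + 1)); rewrite divr_gt0// => /(_ isT).
  have : e / (t1 - t0 + 1) * (t1 - t0 + 1) = e by rewrite mulfVK// gt_eqF.
  by set E := e / _; nra.
move=> e0; have [d d0 acd] := acf _ e0.
have [U [oU MU mUd]] : exists U : set R,
    [/\ open U, M `<=` U & ((@lebesgue_measure R) U < d%:E)%E].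
  have [|U [oU MU mUd]] := @lebesgue_regularity_outer R M d mM _ d0.
    by move: M0 => /= ->; rewrite ltry.
  have mUM : measurable (U `\` M) by apply: measurableD => //; exact: open_measurable.
  exists U; split => //; rewrite -(setDUK MU).
  apply: le_lt_trans (measureU2 _ mM mUM) _.
  by move: M0 => /= ->; rewrite add0e.
(* Invariant of the sweep from [t0] to [s]: the finitely many disjoint intervals collected so far
   lie in [U], and the increment of [f] exceeds the wanted bound by no more than its increments over
   them. As [U] has measure below [d], absolute continuity makes that last sum less than [e]. *)
pose P s := exists n (l r : nat -> R),
  [/\ forall i, (i < n)%N -> [/\ t0 <= l i, l i <= r i & r i <= s],
      trivIset `I_n (fun i => `]l i, r i[%classic),
      forall i, (i < n)%N -> `]l i, r i[ `<=` U &
      f s - f t0 <= G s - G t0 + e * (s - t0)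
                    + \sum_(i < n) `|f (r i) - f (l i)| ].
suff [n [l [r [lr tI sU fs]]]] : P t1.
  apply: (le_trans fs); rewrite lerD2l ltW//.
  pose l' (i : 'I_n) := l i; pose r' (i : 'I_n) := r i.
  have tI' : trivIset setT (fun i : 'I_n => `]l' i, r' i[%classic).
    move=> i j _ _ ij; apply: val_inj; apply: (tI i j (ltn_ord i) (ltn_ord j) ij).
  have lr' i : [/\ t0 <= l' i, l' i <= r' i & r' i <= t1] by exact: lr.
  apply: (acd n l' r') => //.
  rewrite -lte_fin; apply: le_lt_trans mUd; apply: sum_itv_length_le => //.
    by move=> i; have [] := lr' i.
  by move=> i; exact: sU.
apply: real_interval_induction t01 _ _.
  exists 0%N, (fun=> 0), (fun=> 0); split => //.
  by rewrite !subrr big_ord0 mulr0 !addr0.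
(* Across a point off [N] the estimate is extended with the same intervals; across a point of [N]
   the interval []l, r[] is appended to the list. *)
move=> s s01; have [Ns|Ns] := pselect (N s); last first.
  have [rho rho0 Hrho] := H s s01 Ns e e0.
  exists rho => // l r tl ls sr rt1 rl rr [n [a [b [ab tI sU fs]]]].
  exists n, a, b; split => //.
    by move=> i /ab[ta aib bl]; split => //; rewrite (le_trans bl)// (le_trans ls).
  have := Hrho l r tl ls sr rt1 rl rr; move: fs.
  set S := \sum_(i < n) _; nra.
have Us : U s by exact/MU/NM.
have /(nbhs_ballP s)[rho /= rho0 sub] : nbhs s U by exact: open_nbhs_nbhs.
exists rho => // l r tl ls sr rt1 rl rr [n [a [b [ab tI sU fs]]]].
have lr : l <= r by exact: le_trans sr.
pose a' i := if i == n then l else a i.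
pose b' i := if i == n then r else b i.
have an i : (i < n)%N -> a' i = a i by move=> /ltn_eqF; rewrite /a' => ->.
have bn i : (i < n)%N -> b' i = b i by move=> /ltn_eqF; rewrite /b' => ->.
have ann : a' n = l by rewrite /a' eqxx.
have bnn : b' n = r by rewrite /b' eqxx.
have disj i : (i < n)%N -> `]a i, b i[ `&` `]l, r[ = set0.
  move=> /ab[_ _ bl]; apply/seteqP; split => // x /=.
  rewrite !in_itv/= => -[/andP[_ xb] /andP[lx _]].
  by move: (lt_trans lx xb); rewrite ltNge bl.
exists n.+1, a', b'; split.
- move=> i; rewrite ltnS leq_eqVlt => /orP[/eqP ->|ni]; first by rewrite ann bnn.
  rewrite an// bn//; have [ta aib bl] := ab i ni; split => //.
  exact: le_trans lr.
- move=> i j /=; rewrite !ltnS leq_eqVlt => /orP[/eqP ->|ni];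
    rewrite leq_eqVlt => /orP[/eqP ->|nj] //.
  + by rewrite ann bnn an// bn// setIC disj// => -[].
  + by rewrite ann bnn an// bn// disj// => -[].
  + by rewrite !an// !bn//; exact: tI.
- move=> i; rewrite ltnS leq_eqVlt => /orP[/eqP ->|ni]; last first.
    by rewrite an// bn//; exact: sU.
  rewrite ann bnn => x /=; rewrite in_itv/= => /andP[lx xr].
  by apply: sub; rewrite /ball/= ltr_norml; apply/andP; split; lra.
- rewrite big_ord_recr/= ann bnn.
  under eq_bigr => i _ do rewrite an// bn//.
  move: fs; set S := \sum_(i < n) _ => fs.
  have := Gh _ _ lr; have := ler_norm (f r - f l); nra.
Qed.

(* Unlike [ge0_le_integral], no measurability is assumed: the integral of a
   nonnegative function is a supremum over simple functions below it. *)
Lemma ge0_le_integral_nonmeasurable d (T : measurableType d) (R : realType)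
    (mu : {measure set T -> \bar R}) (f g : T -> \bar R) :
  (forall x, 0 <= f x)%E -> (forall x, f x <= g x)%E ->
  (\int[mu]_(x in setT) f x <= \int[mu]_(x in setT) g x)%E.
Proof.
move=> f0 fg; rewrite !ge0_integralTE//; last first.
  by move=> x; exact: le_trans (fg x).
apply: le_ereal_sup => _ [h /= hf <-]; exists h => // x.
exact: le_trans (fg x).
Qed.

(** The interval straddles [s]: subtracting the first-order expansions at its two ends leaves errors
    [e * (r - s)] and [e * (s - l)], which add up to [e * (r - l)]. *)
Lemma is_derive_increment (R : realType) (V : normedModType R) (g : R -> V)
    (s : R) (D : V) : is_derive s 1 g D ->
  forall e : R, 0 < e -> exists2 rho : R, 0 < rho &
    forall l r, l <= s -> s <= r -> s - rho < l -> r < s + rho ->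
      `|g r - g l - (r - l) *: D| <= e * (r - l).
Proof.
move=> [dg gD] e e0.
have cv : h^-1 *: ((g \o shift s) (h *: (1 : R)) - g s) @[h --> (0 : R)^'] --> D.
  by rewrite -gD; exact: dg.
move: cv => /cvgrPdist_le /(_ e e0) [rho /= rho0 H].
have K h : `|h| < rho -> `|g (s + h) - g s - h *: D| <= e * `|h|.
  move=> hr; have [->|h0] := eqVneq h 0.
    by rewrite addr0 subrr scale0r subrr !normr0 mulr0.
  have := H h; rewrite /ball_/= sub0r normrN => /(_ hr h0).
  rewrite [h%:A]mulr1 (addrC h s) => H1.
  have -> : g (s + h) - g s - h *: D = - (h *: (D - h^-1 *: (g (s + h) - g s))).
    by rewrite scalerBr scalerA divff// scale1r opprB.
  by rewrite normrN normrZ mulrC ler_wpM2r.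
exists rho => // l r ls sr lrho rrho.
have -> : g r - g l - (r - l) *: D =
    (g (s + (r - s)) - g s - (r - s) *: D) - (g (s + (l - s)) - g s - (l - s) *: D).
  rewrite !subrKC (_ : r - l = (r - s) - (l - s)); last by ring.
  rewrite scalerBl [in RHS]opprD opprK [RHS]addrACA [in RHS]opprB subrKA.
  by rewrite opprD opprK.
apply: (le_trans (ler_normB _ _)).
have Hr := K (r - s); have Hl := K (l - s).
rewrite ger0_norm ?subr_ge0// in Hr.
rewrite ler0_norm ?subr_le0// in Hl.
have := Hr ltac:(lra); have := Hl ltac:(lra); lra.
Qed.

(** * Linear forms along curves, and extension of curves to the whole line *)

Lemma coord_norm_le (R : realType) (p : heisenberg R) :
  [/\ `|p.1.1| <= `|p|, `|p.1.2| <= `|p| & `|p.2| <= `|p|].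
Proof. by rewrite !prod_normE /= !le_max !lexx /= !orbT. Qed.

(** Scalar test functions for curves: the coordinates are such forms, and so is [vert p] up to a
    constant, with coefficients depending on [p]. *)
Definition lin_form (R : realType) (al be ka : R) (p : heisenberg R) : R :=
  al * p.1.1 + be * p.1.2 + ka * p.2.

Lemma lin_formB (R : realType) (al be ka : R) (p q : heisenberg R) :
  lin_form al be ka (p - q) = lin_form al be ka p - lin_form al be ka q.
Proof. by rewrite /lin_form /=; ring. Qed.

Lemma lin_formZ (R : realType) (al be ka c : R) (p : heisenberg R) :
  lin_form al be ka (c *: p) = c * lin_form al be ka p.
Proof. by rewrite /lin_form /= /GRing.scale /=; ring. Qed.

Lemma lin_form_norm_le (R : realType) (al be ka : R) (p : heisenberg R) :
  `|lin_form al be ka p| <= (`|al| + `|be| + `|ka|) * `|p|.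
Proof.
have [px py pt] := coord_norm_le p.
rewrite /lin_form !mulrDl.
apply: (le_trans (ler_normD _ _)); rewrite lerD//; last first.
  by rewrite normrM ler_wpM2l.
by apply: (le_trans (ler_normD _ _)); rewrite lerD// normrM ler_wpM2l.
Qed.

Lemma lin_form_horizontal (R : realType) (al be ka a b : R) (p : heisenberg R) :
  lin_form al be ka (a *: hX p + b *: hY p) =
    al * a + be * b + ka * (2 * a * p.1.2 - 2 * b * p.1.1).
Proof.
by case: p => [[x y] t]; rewrite /lin_form /= /GRing.scale /=; ring.
Qed.

Lemma absolutely_continuous_lin_form (R : realType) (al be ka t0 t1 : R)
    (g : R -> heisenberg R) :
  absolutely_continuous t0 t1 g ->
  absolutely_continuous (V := R^o) t0 t1 (fun s => lin_form al be ka (g s)).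
Proof.
move=> acg e e0; pose K := `|al| + `|be| + `|ka| + 1.
have K0 : 0 < K by rewrite ltr_wpDl// !addr_ge0.
have [d d0 acd] := acg (e / K) (divr_gt0 e0 K0).
exists d => // n l r lr tI sd.
have := acd n l r lr tI sd; rewrite ltr_pdivlMr// mulrC mulr_sumr.
apply: le_lt_trans; apply: ler_sum => i _.
rewrite -lin_formB; apply: (le_trans (lin_form_norm_le _ _ _ _)).
by rewrite ler_wpM2r// lerDl.
Qed.

(** Extends a curve on [t0, t1] by constants to the whole line, which makes its coordinates
    continuous functions on [R]. *)
Definition clamp (R : realType) (t0 t1 s : R) : R := Num.max t0 (Num.min t1 s).

Lemma clamp_id (R : realType) (t0 t1 s : R) : t0 <= s <= t1 -> clamp t0 t1 s = s.
Proof. by move=> /andP[a b]; rewrite /clamp (min_idPr b) (max_idPr a). Qed.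

Lemma clamp_in (R : realType) (t0 t1 s : R) :
  t0 <= t1 -> t0 <= clamp t0 t1 s <= t1.
Proof. by move=> h; rewrite /clamp le_max lexx/= ge_max h ge_min lexx. Qed.

Lemma clamp_mono (R : realType) (t0 t1 x y : R) :
  x <= y -> clamp t0 t1 x <= clamp t0 t1 y.
Proof.
move=> xy; rewrite /clamp.
by case: (leP t1 x) => h1; case: (leP t1 y) => h2; case: (leP t0 t1) => h3;
  case: (leP t0 x) => h4; case: (leP t0 y) => h5; lra.
Qed.

Lemma clamp_sub_le (R : realType) (t0 t1 x y : R) :
  x <= y -> clamp t0 t1 y - clamp t0 t1 x <= y - x.
Proof.
move=> xy; rewrite /clamp.
by case: (leP t1 x) => h1; case: (leP t1 y) => h2; case: (leP t0 t1) => h3;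
  case: (leP t0 x) => h4; case: (leP t0 y) => h5; lra.
Qed.

Lemma absolutely_continuous_clamp (R : realType) (t0 t1 : R) (f : R -> R) :
  t0 <= t1 -> absolutely_continuous (V := R^o) t0 t1 f ->
  continuous (f \o clamp t0 t1).
Proof.
move=> t01 acf s; apply/cvgrPdist_le => e e0.
have [d d0 acd] := acf e e0.
have K x y : x <= y -> y - x < d ->
    `|f (clamp t0 t1 y) - f (clamp t0 t1 x)| < e.
  move=> xy yxd.
  have := acd 1%N (fun=> clamp t0 t1 x) (fun=> clamp t0 t1 y).
  rewrite !big_ord1; apply.
  - move=> _; have /andP[? ?] := clamp_in x t01; have /andP[? ?] := clamp_in y t01.
    by split => //; exact: clamp_mono.
  - by move=> i j _ _ _; rewrite !ord1.
  - by apply: le_lt_trans yxd; exact: clamp_sub_le.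
exists d => // t; rewrite /ball_/= => std; apply: ltW.
have [st|/ltW ts] := leP s t.
  by rewrite distrC; apply: K => //; move: std; rewrite distrC ger0_norm ?subr_ge0.
by apply: K => //; move: std; rewrite ger0_norm ?subr_ge0.
Qed.

(** * Lower bounds for the Carnot-Caratheodory distance *)

(* On a set where [f] has derivative [df], [df] is a pointwise limit of
   difference quotients, hence Borel. *)
Lemma measurable_fun_derivative (R : realType) (f df : R -> R) (E : set R) :
  continuous f -> measurable E ->
  (forall s, E s -> forall e : R, 0 < e -> exists2 rho : R, 0 < rho &
     forall h, 0 <= h -> h < rho -> `|f (s + h) - f s - h * df s| <= e * h) ->
  measurable_fun E df.
Proof.
move=> cf mE H; apply/measurable_EFinP.
pose q n s := n.+1%:R * (f (s + n.+1%:R^-1) - f s).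
apply: (emeasurable_fun_cvg (fun n s => (q n s)%:E)).
  move=> n; apply/measurable_EFinP; apply: (@measurable_funS _ _ _ _ setT) => //.
  apply: continuous_measurable_fun => s; rewrite /q.
  apply: cvgM; first exact: cvg_cst.
  apply: cvgB; last exact: cf.
  apply: (cvg_comp (fun s => s + n.+1%:R^-1) f); last exact: cf.
  by apply: cvgD; [exact: cvg_id|exact: cvg_cst].
move=> s Es; apply/cvg_EFin; first by near=> n.
apply/cvgrPdist_le => e e0.
have [rho rho0 Hr] := H s Es e e0.
near=> n.
have n0 : 0 < n.+1%:R^-1 :> R by rewrite invr_gt0.
have nr : n.+1%:R^-1 < rho by near: n; exact: near_infty_natSinv_lt (PosNum rho0).
rewrite distrC /q /=; have := Hr _ (ltW n0) nr.
have -> : f (s + n.+1%:R^-1) - f s - n.+1%:R^-1 * df s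
   = n.+1%:R^-1 * (n.+1%:R * (f (s + n.+1%:R^-1) - f s) - df s).
  by rewrite mulrBr mulrA mulVf ?mul1r// pnatr_eq0.
by rewrite normrM (gtr0_norm n0) mulrC ler_pM2r.
Unshelve. all: by end_near. Qed.

(** [G] is the primitive of the speed, set to 0 off a set [E] of full measure in the interval where
    the curve has its prescribed derivative. On [E] the coefficients [a] and [b] are derivatives of
    the first two coordinates, so the speed is measurable there; Lebesgue differentiation then gives
    the last clause almost everywhere. *)
Lemma horizontal_majorant (R : realType) (t0 t1 ell : R)
    (g : R -> heisenberg R) (a b : R -> R) :
  t0 <= t1 -> horizontal_with t0 t1 g a b ->
  (cc_length t0 t1 a b <= ell%:E)%E ->
  exists (G : R -> R) (N : set R),
  [/\ {homo G : x y / x <= y}, forall x y, G y - G x <= ell,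
      (@lebesgue_measure R).-negligible N &
      forall s, t0 <= s <= t1 -> ~ N s ->
        is_derive s 1 g (a s *: hX (g s) + b s *: hY (g s)) /\
        forall e : R, 0 < e -> exists2 rho : R, 0 < rho &
        forall l r, l <= s -> s <= r -> s - rho < l -> r < s + rho ->
          Num.sqrt (a s ^+ 2 + b s ^+ 2) * (r - l) <= G r - G l + e * (r - l)].
Proof.
move=> t01 [acg [M1 [mM1 M10 badM1]]] len.
set v := fun s => Num.sqrt (a s ^+ 2 + b s ^+ 2).
pose E := `]t0, t1[%classic `\` M1.
have mE : measurable E by apply: measurableD => //; exact: measurable_itv.
have Eg s : E s -> is_derive s 1 g (a s *: hX (g s) + b s *: hY (g s)).
  move=> [s01 nM]; apply: contrapT => nd; apply: nM; apply: badM1 => /= H.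
  exact/nd/H.
have dlin al be ka s : E s -> forall e : R, 0 < e -> exists2 rho : R, 0 < rho &
    forall h, 0 <= h -> h < rho ->
    `|(lin_form al be ka \o g \o clamp t0 t1) (s + h) -
      (lin_form al be ka \o g \o clamp t0 t1) s -
      h * (lin_form al be ka (a s *: hX (g s) + b s *: hY (g s)))| <= e * h.
  move=> Es e e0; pose K := `|al| + `|be| + `|ka| + 1.
  have K0 : 0 < K by rewrite ltr_wpDl// !addr_ge0.
  have [rho rho0 H] := is_derive_increment (Eg s Es) (divr_gt0 e0 K0).
  have [/=] := Es; rewrite in_itv/= => /andP[ts st] _.
  (* The bound [t1 - s] keeps [s + h] in [t0, t1], where [clamp] is the identity. *)
  exists (Num.min rho (t1 - s)); first by rewrite lt_min rho0 subr_gt0.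
  move=> h h0; rewrite lt_min => /andP[hr ht].
  rewrite /= !clamp_id; last 2 first.
    by apply/andP; split; lra.
    by apply/andP; split; lra.
  rewrite -lin_formZ -!lin_formB.
  apply: (le_trans (lin_form_norm_le _ _ _ _)).
  have := H s (s + h); rewrite lexx lerDl h0 => /(_ isT isT).
  rewrite (_ : s + h - s = h); last by ring.
  move=> /(_ ltac:(lra) ltac:(lra)) H1.
  apply: (@le_trans _ _ (K * (e / K * h))).
    by rewrite ler_pM// ?addr_ge0// lerDl.
  by rewrite mulrA (mulrC K) mulfVK// gt_eqF.
have cont al be ka : continuous (lin_form al be ka \o g \o clamp t0 t1).
  apply: (@absolutely_continuous_clamp R t0 t1 (lin_form al be ka \o g)) => //.
  exact: absolutely_continuous_lin_form.
have ma : measurable_fun E a.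
  apply: (measurable_fun_derivative (cont 1 0 0) mE) => s Es e e0.
  have [rho rho0 H] := dlin 1 0 0 s Es e e0; exists rho => // h h0 hr.
  by have := H h h0 hr; rewrite lin_form_horizontal !mul0r !addr0 mul1r.
have mb : measurable_fun E b.
  apply: (measurable_fun_derivative (cont 0 1 0) mE) => s Es e e0.
  have [rho rho0 H] := dlin 0 1 0 s Es e e0; exists rho => // h h0 hr.
  by have := H h h0 hr; rewrite lin_form_horizontal !mul0r !addr0 add0r mul1r.
have mv : measurable_fun E v.
  apply: measurableT_comp.
    by apply: continuous_measurable_fun; exact: sqrt_continuous.
  by apply: measurable_funD; exact: measurable_funX.
pose V := v \_ E.
have mV : measurable_fun setT V by move/(measurable_restrictT _ mE) : mv; exact.
have V0 s : 0 <= V s by rewrite /V patchE; case: ifP => // _; exact: sqrtr_ge0.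
have intV : ((\int[lebesgue_measure]_(x in setT) (V x)%:E) <= ell%:E)%E.
  apply: le_trans len; rewrite /cc_length [leRHS]integral_mkcond.
  apply: ge0_le_integral_nonmeasurable => x; first by rewrite lee_fin.
  rewrite /V !patchE; case: ifPn => xE; last first.
    by case: ifP => // _; rewrite lee_fin sqrtr_ge0.
  move: xE; rewrite inE => -[/= + _]; rewrite in_itv/= => /andP[/ltW xa /ltW xb].
  by rewrite ifT// inE/= in_itv/= xa xb.
have iV : lebesgue_measure.-integrable setT (EFin \o V).
  apply/integrableP; split; first exact/measurable_EFinP.
  apply: le_lt_trans (ltry ell); apply: le_trans intV.
  rewrite le_eqVlt; apply/orP; left; apply/eqP; apply: eq_integral => x _ /=.
  by rewrite ger0_norm.
have iVS (A : set R) : measurable A -> lebesgue_measure.-integrable A (EFin \o V).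
  by move=> mA; exact: integrableS iV.
have locV : locally_integrable setT V by exact: open_integrable_locally openT iV.
pose G x := (\int[lebesgue_measure]_(t in `]-oo, x]) (V t))%R.
have [M2 [mM2 M20 badM2]] := FTC1Ny (fun y => iVS `]-oo, y]%classic (measurable_itv _)) locV.
have GE x : (G x)%:E = (\int[lebesgue_measure]_(t in `]-oo, x]) (V t)%:E)%E.
  by rewrite /G /Rintegral fineK//; apply: integrable_fin_num; rewrite //=; exact: iVS.
have subV (A B : set R) : measurable A -> measurable B -> A `<=` B ->
    (\int[lebesgue_measure]_(t in A) (V t)%:E <=
     \int[lebesgue_measure]_(t in B) (V t)%:E)%E.
  move=> mA mB AB; apply: ge0_subset_integral => //.
    have mVB : measurable_fun B V by exact: measurable_funTS.
    exact/measurable_EFinP.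
  by move=> t _; rewrite lee_fin.
have G0 x : 0 <= G x.
  by rewrite -lee_fin GE; apply: integral_ge0 => t _; rewrite lee_fin.
have Gell x : G x <= ell.
  rewrite -lee_fin GE; apply: le_trans intV.
  exact: subV.
(* The endpoints join the exceptional set because [E] lies in the open interval. *)
exists G, ((M1 `|` M2) `|` [set t0; t1]); split.
- move=> x y xy; rewrite -lee_fin !GE.
  apply: subV; rewrite ?measurable_itv//.
  by move=> t /=; rewrite !in_itv/= => /le_trans; apply.
- by move=> x y; have := G0 x; have := Gell y; lra.
- apply: negligibleU.
    by apply: negligibleU; [exists M1; split|exists M2; split].
  have neg1 t : (@lebesgue_measure R).-negligible [set t].
    by apply/negligibleP => //; exact: lebesgue_measure_set1.
  exact: negligibleU.
- move=> s /andP[ts st] nN.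
  have Es : E s.
    split; last by move=> ?; apply: nN; left; left.
    rewrite /= in_itv/= !lt_neqAle ts st !andbT.
    by apply/andP; split; apply/eqP => e; apply: nN; right; [left|right].
  split; first exact: Eg.
  have [dG GV] : derivable G s 1 /\ G^`()%classic s = V s.
    by apply: contrapT => nd; apply: nN; left; right; apply: badM2.
  have iG : is_derive s 1 G (V s) by apply: DeriveDef => //; rewrite -GV derive1E.
  move=> e e0; have [rho rho0 H] := is_derive_increment iG e0.
  exists rho => // l r ls sr sl rs.
  have := H l r ls sr sl rs; rewrite ler_norml => /andP[+ _].
  rewrite {1}/V patchE mem_set// [(r - l) *: _]mulrC -/(v s).
  lra.
Qed.

(** Off [N] the derivative of the form along [g] is at most [C] times the speed, so [C * G] controls
    its increments as [absolutely_continuous_increment_le] requires. The intermediate end [u] is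
    there because the estimate of [vert] uses bounds on the first two coordinates at every time. *)
Lemma horizontal_lin_form_le (R : realType) (t0 t1 u al be ka C : R)
    (g : R -> heisenberg R) (a b G : R -> R) (N : set R) :
  t0 <= u -> u <= t1 -> 0 <= C ->
  absolutely_continuous t0 t1 g ->
  {homo G : x y / x <= y} -> (@lebesgue_measure R).-negligible N ->
  (forall s, t0 <= s <= t1 -> ~ N s ->
     is_derive s 1 g (a s *: hX (g s) + b s *: hY (g s)) /\
     forall e : R, 0 < e -> exists2 rho : R, 0 < rho &
     forall l r, l <= s -> s <= r -> s - rho < l -> r < s + rho ->
       Num.sqrt (a s ^+ 2 + b s ^+ 2) * (r - l) <= G r - G l + e * (r - l)) ->
  (forall s, t0 <= s <= u -> ~ N s ->
     lin_form al be ka (a s *: hX (g s) + b s *: hY (g s)) <=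
     C * Num.sqrt (a s ^+ 2 + b s ^+ 2)) ->
  lin_form al be ka (g u) - lin_form al be ka (g t0) <= C * (G u - G t0).
Proof.
move=> t0u ut1 C0 acg Gh Nn H Hlam; rewrite mulrBr.
apply: (@absolutely_continuous_increment_le R t0 u (lin_form al be ka \o g)
  (fun s => C * G s) N) => //.
- apply: absolutely_continuous_lin_form => e e0; have [d d0 acd] := acg e e0.
  exists d => // n l r lr; apply: acd => i; have [? ? ?] := lr i.
  by split => //; exact: le_trans ut1.
- by move=> x y xy; rewrite ler_wpM2l// Gh.
move=> s /andP[ts su] nN e e0.
have s01 : t0 <= s <= t1 by rewrite ts (le_trans su).
have [dg HG] := H s s01 nN.
pose K := `|al| + `|be| + `|ka| + 1.
have K0 : 0 < K by rewrite ltr_wpDl// !addr_ge0.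
have C1 : 0 < C + 1 by rewrite ltr_wpDl.
have e2 : 0 < e / 2 by rewrite divr_gt0.
(* Half of [e] pays for the expansion of [g], where the form costs a factor [K]; the other half pays
   for [G], where the factor is [C]. *)
have [rho1 rho10 H1] := is_derive_increment dg (divr_gt0 e2 K0).
have [rho2 rho20 H2] := HG _ (divr_gt0 e2 C1).
exists (Num.min rho1 rho2); first by rewrite lt_min rho10.
move=> l r tl ls sr ru sl rs.
have m1 : Num.min rho1 rho2 <= rho1 by rewrite ge_min lexx.
have m2 : Num.min rho1 rho2 <= rho2 by rewrite ge_min lexx orbT.
have {}H1 := H1 l r ls sr ltac:(lra) ltac:(lra).
have {}H2 := H2 l r ls sr ltac:(lra) ltac:(lra).
have lr : 0 <= r - l by rewrite subr_ge0; exact: le_trans sr.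
have lam : lin_form al be ka (a s *: hX (g s) + b s *: hY (g s)) * (r - l) <=
    C * Num.sqrt (a s ^+ 2 + b s ^+ 2) * (r - l).
  by rewrite ler_wpM2r// Hlam// ts.
have {}H1 : `|lin_form al be ka (g r) - lin_form al be ka (g l) -
    (r - l) * lin_form al be ka (a s *: hX (g s) + b s *: hY (g s))| <=
    e / 2 * (r - l).
  rewrite -lin_formZ -!lin_formB; apply: (le_trans (lin_form_norm_le _ _ _ _)).
  apply: (@le_trans _ _ (K * (e / 2 / K * (r - l)))).
    by rewrite ler_pM// ?addr_ge0// lerDl.
  by rewrite mulrA (mulrC K) mulfVK// gt_eqF.
have {}H2 : C * (Num.sqrt (a s ^+ 2 + b s ^+ 2) * (r - l)) <=
    C * (G r - G l) + e / 2 * (r - l).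
  apply: (le_trans (ler_wpM2l C0 H2)); rewrite mulrDr lerD2l mulrA.
  rewrite ler_wpM2r// mulrCA ler_piMr ?(ltW e2)//.
  by rewrite ler_pdivrMr// mul1r lerDl.
move: H1 => /(le_trans (ler_norm _)) /=; nra.
Qed.

(* The last coordinate of [p^-1 * q]. *)
Definition vert (R : realType) (p q : heisenberg R) : R :=
  q.2 - p.2 + 2 * (p.1.1 * q.1.2 - q.1.1 * p.1.2).

Lemma normr_le_sqrt_sqrD (R : realType) (a b : R) :
  `|a| <= Num.sqrt (a ^+ 2 + b ^+ 2) /\ `|b| <= Num.sqrt (a ^+ 2 + b ^+ 2).
Proof.
by split; rewrite -sqrtr_sqr ler_sqrt ?addr_ge0 ?sqr_ge0// ?lerDl ?lerDr sqr_ge0.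
Qed.

(** If the curve starts over (x0, y0), then [vert] from its starting point has derivative 2((y -
    y0)a - (x - x0)b). The first two bounds hold at every time, so this is at most [4 * ell] times
    the speed, and integration gives [4 * ell ^+ 2]. *)
Lemma horizontal_curve_bounds (R : realType) (t0 t1 ell : R)
    (g : R -> heisenberg R) (a b : R -> R) :
  t0 <= t1 -> horizontal_with t0 t1 g a b ->
  (cc_length t0 t1 a b <= ell%:E)%E ->
  [/\ `|(g t1).1.1 - (g t0).1.1| <= ell, `|(g t1).1.2 - (g t0).1.2| <= ell &
      `|vert (g t0) (g t1)| <= 4 * ell ^+ 2].
Proof.
move=> t01 hg len.
have [G [N [Gh Gell Nn H]]] := horizontal_majorant t01 hg len.
have acg := hg.1.
have ell0 : 0 <= ell by apply: le_trans (Gell t0 t0); rewrite subrr.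
have key al be ka C u : t0 <= u -> u <= t1 -> 0 <= C ->
    (forall s, t0 <= s <= u ->
       al * a s + be * b s + ka * (2 * a s * (g s).1.2 - 2 * b s * (g s).1.1) <=
       C * Num.sqrt (a s ^+ 2 + b s ^+ 2)) ->
    lin_form al be ka (g u) - lin_form al be ka (g t0) <= C * ell.
  move=> t0u ut1 C0 Hs.
  apply: le_trans (ler_wpM2l C0 (Gell t0 u)).
  apply: (horizontal_lin_form_le t0u ut1 C0 acg Gh Nn H) => s s0u _.
  by rewrite lin_form_horizontal; exact: Hs.
have ab_le s := normr_le_sqrt_sqrD (a s) (b s).
have xb u : t0 <= u -> u <= t1 -> `|(g u).1.1 - (g t0).1.1| <= ell.
  move=> t0u ut1.
  have := key (-1) 0 0 1 u t0u ut1 ler01; have := key 1 0 0 1 u t0u ut1 ler01.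
  rewrite /lin_form => K1 K2; rewrite ler_norml; apply/andP; split.
    suff : -1 * (g u).1.1 + 0 * (g u).1.2 + 0 * (g u).2 -
      (-1 * (g t0).1.1 + 0 * (g t0).1.2 + 0 * (g t0).2) <= 1 * ell by lra.
    by apply: K2 => s _; have [+ _] := ab_le s; rewrite ler_norml => /andP[+ _]; lra.
  suff : 1 * (g u).1.1 + 0 * (g u).1.2 + 0 * (g u).2 -
      (1 * (g t0).1.1 + 0 * (g t0).1.2 + 0 * (g t0).2) <= 1 * ell by lra.
  by apply: K1 => s _; have [+ _] := ab_le s; rewrite ler_norml => /andP[_]; lra.
have yb u : t0 <= u -> u <= t1 -> `|(g u).1.2 - (g t0).1.2| <= ell.
  move=> t0u ut1.
  have := key 0 (-1) 0 1 u t0u ut1 ler01; have := key 0 1 0 1 u t0u ut1 ler01.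
  rewrite /lin_form => K1 K2; rewrite ler_norml; apply/andP; split.
    suff : 0 * (g u).1.1 + -1 * (g u).1.2 + 0 * (g u).2 -
      (0 * (g t0).1.1 + -1 * (g t0).1.2 + 0 * (g t0).2) <= 1 * ell by lra.
    by apply: K2 => s _; have [_ +] := ab_le s; rewrite ler_norml => /andP[+ _]; lra.
  suff : 0 * (g u).1.1 + 1 * (g u).1.2 + 0 * (g u).2 -
      (0 * (g t0).1.1 + 1 * (g t0).1.2 + 0 * (g t0).2) <= 1 * ell by lra.
  by apply: K1 => s _; have [_ +] := ab_le s; rewrite ler_norml => /andP[_]; lra.
split; [exact: xb|exact: yb|].
have C0 : 0 <= 4 * ell by rewrite mulr_ge0.
(* The factor [e] is a sign: the values 1 and -1 bound [vert] from both sides by one argument. *)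
have vertE e : vert (g t0) (g t1) * e =
    lin_form (- (2 * (g t0).1.2) * e) (2 * (g t0).1.1 * e) e (g t1) -
    lin_form (- (2 * (g t0).1.2) * e) (2 * (g t0).1.1 * e) e (g t0).
  by rewrite /vert /lin_form; ring.
have bnd e s : `|e| = 1 -> t0 <= s <= t1 ->
    (- (2 * (g t0).1.2) * e) * a s + (2 * (g t0).1.1 * e) * b s +
    e * (2 * a s * (g s).1.2 - 2 * b s * (g s).1.1) <=
    4 * ell * Num.sqrt (a s ^+ 2 + b s ^+ 2).
  move=> e1 /andP[t0s st1]; have [av bv] := ab_le s.
  have -> : (- (2 * (g t0).1.2) * e) * a s + (2 * (g t0).1.1 * e) * b s +
      e * (2 * a s * (g s).1.2 - 2 * b s * (g s).1.1) =
      2 * (e * (((g s).1.2 - (g t0).1.2) * a s - ((g s).1.1 - (g t0).1.1) * b s)).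
    by ring.
  have -> : 4 * ell * Num.sqrt (a s ^+ 2 + b s ^+ 2) =
      2 * (ell * Num.sqrt (a s ^+ 2 + b s ^+ 2) +
           ell * Num.sqrt (a s ^+ 2 + b s ^+ 2)) by ring.
  rewrite ler_pM2l//; apply: (le_trans (ler_norm _)).
  rewrite normrM e1 mul1r; apply: (le_trans (ler_normB _ _)).
  by rewrite !normrM lerD// ler_pM// ?xb ?yb.
have -> : 4 * ell ^+ 2 = 4 * ell * ell by rewrite expr2 mulrA.
rewrite ler_norml; apply/andP; split.
  rewrite lerNl -mulrN1 vertE; apply: key => // s; apply: bnd.
  by rewrite normrN1.
by rewrite -[vert _ _]mulr1 vertE; apply: key => // s; apply: bnd; rewrite normr1.
Qed.

Lemma dcc_bounds (R : realType) (p q : heisenberg R) (d : R) :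
  (dcc p q <= d%:E)%E ->
  [/\ `|q.1.1 - p.1.1| <= d, `|q.1.2 - p.1.2| <= d &
      `|vert p q| <= 4 * d ^+ 2].
Proof.
move=> pqd.
have K e : 0 < e -> [/\ `|q.1.1 - p.1.1| <= d + e, `|q.1.2 - p.1.2| <= d + e &
      `|vert p q| <= 4 * (d + e) ^+ 2].
  move=> e0; have : (dcc p q < (d + e)%:E)%E.
    by apply: (le_lt_trans pqd); rewrite lte_fin ltrDl.
  move=> /ereal_inf_lt [_ [t0 [t1 [g [a [b [t01 hg <- <- ->]]]]]] /ltW].
  exact: horizontal_curve_bounds.
split; try by apply/ler_addgt0Pr => e /K[].
(* For 0 < h <= 1 one has 4(d + h)^2 <= 4d^2 + h(8|d| + 4), which dictates [m]. *)
apply/ler_addgt0Pr => e e0; pose m := 8 * `|d| + 4.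
have m0 : 0 < m by rewrite /m ltr_wpDl// mulr_ge0.
pose h := Num.min 1 (e / m).
have h0 : 0 < h by rewrite lt_min ltr01 divr_gt0.
have h1 : h <= 1 by rewrite ge_min lexx.
have hm : h * m <= e by rewrite -ler_pdivlMr// ge_min lexx orbT.
have [_ _ /le_trans] := K h h0; apply.
have := ler_norm d; rewrite /m in hm; nra.
Qed.

(** * Polygonal horizontal curves *)

(** The derivative as a first-order expansion, a form that passes directly through gluing and affine
    changes of parameter. *)
Definition deriv_at (R : realType) (V : normedModType R) (g : R -> V) (s : R)
    (D : V) : Prop :=
  forall e : R, 0 < e -> exists2 rho : R, 0 < rho &
    forall h, `|h| < rho -> `|g (s + h) - g s - h *: D| <= e * `|h|.

Lemma deriv_at_is_derive (R : realType) (V : normedModType R) (g : R -> V)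
    (s : R) (D : V) : deriv_at g s D -> is_derive s 1 g D.
Proof.
move=> H.
have cv : h^-1 *: ((g \o shift s) (h *: (1 : R)) - g s) @[h --> (0 : R)^'] --> D.
  apply/cvgrPdist_le => e e0; have [rho rho0 Hr] := H e e0.
  exists rho => //= h; rewrite /ball_/= sub0r normrN => hr h0.
  have := Hr h hr; rewrite [h%:A]mulr1 (addrC h s) => Hh.
  have -> : D - h^-1 *: (g (s + h) - g s) =
      - (h^-1 *: (g (s + h) - g s - h *: D)).
    by rewrite [in RHS]scalerBr scalerA mulVf// scale1r opprB.
  by rewrite normrN normrZ normfV mulrC ler_pdivrMr ?normr_gt0.
have dg : derivable g s 1 by apply/cvg_ex; exists D.
by split => //; exact: cvg_lim cv.
Qed.

Lemma deriv_at_near (R : realType) (V : normedModType R) (f g : R -> V)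
    (s rho : R) (D : V) : 0 < rho ->
  (forall h, `|h| < rho -> f (s + h) = g (s + h)) ->
  deriv_at f s D -> deriv_at g s D.
Proof.
move=> rho0 fg H e e0; have [r r0 Hr] := H e e0.
exists (Num.min rho r); first by rewrite lt_min rho0 r0.
move=> h; rewrite lt_min => /andP[h1 h2].
rewrite -fg//; have := fg 0; rewrite normr0 addr0 => <-//.
exact: Hr.
Qed.

(* A curve parametrized by arc length, smooth off the finite set [F] of corners;
   its cc-length is [t1 - t0] because [a] and [b] are normalized everywhere. *)
Definition unit_path (R : realType) (t0 t1 : R) (g : R -> heisenberg R) : Prop :=
  t0 <= t1 /\
  (exists K : R, forall l r, t0 <= l -> l <= r -> r <= t1 ->
     `|g r - g l| <= K * (r - l)) /\
  exists (a b : R -> R) (F : seq R), (forall s, a s ^+ 2 + b s ^+ 2 = 1) /\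
    forall s, t0 < s -> s < t1 -> s \notin F ->
      deriv_at g s (a s *: hX (g s) + b s *: hY (g s)).

Lemma unit_path_sub (R : realType) (t0 t1 s0 s1 : R) (g : R -> heisenberg R) :
  t0 <= s0 -> s0 <= s1 -> s1 <= t1 -> unit_path t0 t1 g -> unit_path s0 s1 g.
Proof.
move=> t0s0 s01 s1t1 [_ [[K HK] [a [b [F [ab H]]]]]]; split => //; split.
  by exists K => l r s0l lr rs1; apply: HK => //; lra.
by exists a, b, F; split => // s s0s ss1; apply: H; lra.
Qed.

(** The Lipschitz bound gives absolute continuity, the finite set of corners is negligible, and unit
    speed makes the cc-length equal to [t1 - t0]. *)
Lemma dcc_unit_path (R : realType) (t0 t1 : R) (g : R -> heisenberg R) :
  unit_path t0 t1 g -> (dcc (g t0) (g t1) <= (t1 - t0)%:E)%E.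
Proof.
move=> [t01 [[K HK] [a [b [F [ab H]]]]]].
apply: ereal_inf_lbound; exists t0, t1, g, a, b; split => //; last first.
  rewrite /cc_length; under eq_integral do rewrite ab sqrtr1.
  rewrite integral_cst//= mul1e lebesgue_measure_itv/= lte_fin.
  by move: t01; rewrite le_eqVlt => /orP[/eqP ->|->]; rewrite ?ltxx ?subrr.
split.
  move=> e e0; exists (e / (`|K| + 1)).
    by rewrite divr_gt0// ltr_wpDl.
  move=> n l r lr _; rewrite ltr_pdivlMr ?ltr_wpDl// mulrC mulr_sumr.
  apply: le_lt_trans; apply: ler_sum => i _; have [? ? ?] := lr i.
  apply: (le_trans (HK _ _ _ _ _)) => //; rewrite ler_wpM2r ?subr_ge0//.
  by apply: (le_trans (ler_norm _)); rewrite lerDl.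
have negF : (@lebesgue_measure R).-negligible [set` F].
  elim: F {H} => [|x F IH]; first by rewrite set_nil; exact: negligible_set0.
  have xF : [set` x :: F] `<=` [set x] `|` [set` F].
    by move=> y /=; rewrite in_cons => /orP[/eqP|]; [left|right].
  suff : (@lebesgue_measure R).-negligible ([set x] `|` [set` F]).
    by apply: negligibleS => //; exact: xF.
  apply: negligibleU => //.
  by apply/negligibleP => //; exact: lebesgue_measure_set1.
apply: negligibleS negF => s /= nH; apply: contrapT => sF; apply: nH.
rewrite in_itv/= => /andP[t0s st1]; apply/deriv_at_is_derive/H => //.
exact/negP.
Qed.

(** [k] = 1 translates the parameter and [k] = -1 reverses it, so concatenation and reversal of
    curves share this chain rule. *)
Lemma deriv_at_affine (R : realType) (V : normedModType R) (g : R -> V)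
    (c k s : R) (D : V) : `|k| = 1 ->
  deriv_at g (c + k * s) D -> deriv_at (fun s => g (c + k * s)) s (k *: D).
Proof.
move=> k1 H e e0; have [rho rho0 Hr] := H e e0; exists rho => // h hr.
have := Hr (k * h); rewrite normrM k1 mul1r => /(_ hr).
by rewrite mulrDr addrA scalerA (mulrC h).
Qed.

Lemma unit_path_shift (R : realType) (t0 t1 c : R) (g : R -> heisenberg R) :
  unit_path t0 t1 g -> unit_path (t0 - c) (t1 - c) (fun s => g (c + 1 * s)).
Proof.
move=> [t01 [[K HK] [a [b [F [ab H]]]]]]; split; first by rewrite lerB.
split.
  exists K => l r ? ? ?; rewrite (_ : r - l = (c + 1 * r) - (c + 1 * l)); last by ring.
  by apply: HK; lra.
exists (fun s => a (c + 1 * s)), (fun s => b (c + 1 * s)), [seq x - c | x <- F].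
split=> [s|s s0 s1 sF]; first exact: ab.
rewrite -[X in deriv_at _ _ X]scale1r.
apply: (@deriv_at_affine _ _ g c 1); rewrite ?normr1//; apply: H; [lra|lra|].
apply: contra sF => sF; apply/mapP; exists (c + 1 * s) => //; ring.
Qed.

Lemma unit_path_rev (R : realType) (t0 t1 c : R) (g : R -> heisenberg R) :
  unit_path t0 t1 g -> unit_path (c - t1) (c - t0) (fun s => g (c + (-1) * s)).
Proof.
move=> [t01 [[K HK] [a [b [F [ab H]]]]]]; split; first by rewrite lerB.
split.
  exists K => l r ? ? ?; rewrite distrC.
  rewrite (_ : r - l = (c + (-1) * l) - (c + (-1) * r)); last by ring.
  by apply: HK; lra.
exists (fun s => - a (c + (-1) * s)), (fun s => - b (c + (-1) * s)), [seq c - x | x <- F].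
split=> [s|s s0 s1 sF]; first by rewrite !sqrrN ab.
rewrite !scaleNr -opprD -[X in deriv_at _ _ X]scaleN1r.
apply: (@deriv_at_affine _ _ g c (-1)); rewrite ?normrN1//; apply: H; [lra|lra|].
by apply: contra sF => sF; apply/mapP; exists (c + (-1) * s) => //; ring.
Qed.

Lemma unit_path_cat (R : realType) (t0 t1 t2 : R) (g h : R -> heisenberg R) :
  g t1 = h t1 -> unit_path t0 t1 g -> unit_path t1 t2 h ->
  unit_path t0 t2 (fun s => if s <= t1 then g s else h s).
Proof.
move=> gh [t01 [[K HK] [a [b [F [ab H]]]]]] [t12 [[K' HK'] [a' [b' [F' [ab' H']]]]]].
split; first exact: le_trans t12.
split.
  exists (Num.max K K') => l r t0l lr rt2.
  have mK : K <= Num.max K K' by rewrite le_max lexx.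
  have mK' : K' <= Num.max K K' by rewrite le_max lexx orbT.
  case: (leP l t1) => lt1; case: (leP r t1) => rt1.
  - by apply: (le_trans (HK _ _ _ _ _)) => //; rewrite ler_wpM2r// subr_ge0.
  - rewrite -(subrKA (h t1)) -{2}gh; apply: (le_trans (ler_normD _ _)).
    have A1 : `|h r - h t1| <= Num.max K K' * (r - t1).
      apply: (le_trans (HK' _ _ _ _ _)) => //; first exact: ltW.
      by rewrite ler_wpM2r// subr_ge0 ltW.
    have A2 : `|g t1 - g l| <= Num.max K K' * (t1 - l).
      by apply: (le_trans (HK _ _ _ _ _)) => //; rewrite ler_wpM2r// subr_ge0.
    rewrite (_ : r - l = (r - t1) + (t1 - l)); last by ring.
    by rewrite mulrDr lerD.
  - by move: (le_lt_trans lr (le_lt_trans rt1 lt1)); rewrite ltxx.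
  - apply: (le_trans (HK' _ _ _ _ _)) => //; first exact: ltW.
    by rewrite ler_wpM2r// subr_ge0.
(* The junction [t1] becomes a corner; away from it the glued curve agrees locally with one of the
   two pieces. *)
exists (fun s => if s <= t1 then a s else a' s), (fun s => if s <= t1 then b s else b' s), (t1 :: F ++ F').
split=> [s|s s0 s2]; first by case: ifP.
rewrite in_cons mem_cat !negb_or => /and3P[st1 sF sF'].
have [ss|ss] := leP s t1.
  have {}ss : s < t1 by rewrite lt_neqAle st1.
  apply: (@deriv_at_near _ _ g _ _ (t1 - s)); rewrite ?subr_gt0//.
    move=> x; rewrite ltr_norml => /andP[_ xs].
    by rewrite ifT//; lra.
  exact: H.
apply: (@deriv_at_near _ _ h _ _ (s - t1)); rewrite ?subr_gt0//.
  move=> x; rewrite ltr_norml => /andP[xs _].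
  by rewrite ifF//; apply/negbTE; rewrite -ltNge; lra.
exact: H'.
Qed.

(** The curve is a left translate of a one-parameter subgroup; in coordinates it is affine with
    velocity [D], so its first-order expansion is exact. *)
Lemma unit_path_seg (R : realType) (p : heisenberg R) (al be L : R) :
  al * be = 0 -> al ^+ 2 + be ^+ 2 = 1 -> 0 <= L ->
  unit_path 0 L (fun s => hmul p (s * al, s * be, 0)).
Proof.
move=> ab0 ab1 L0; case: p => [[x y] t].
pose D : heisenberg R := (al, be, 2 * (al * y - x * be)).
have incr l r : hmul (x, y, t) (r * al, r * be, 0) -
    hmul (x, y, t) (l * al, l * be, 0) = (r - l) *: D.
  apply/eqP; rewrite !xpair_eqE /=; apply/andP; split; last first.
    by rewrite /GRing.scale /=; apply/eqP; ring.
  by apply/andP; split; rewrite /GRing.scale /=; apply/eqP; ring.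
split => //; split.
  exists `|D| => l r _ lr _; rewrite incr normrZ ger0_norm ?subr_ge0//.
  by rewrite mulrC.
exists (fun=> al), (fun=> be), [::]; split => // s _ _ _.
have -> : al *: hX (hmul (x, y, t) (s * al, s * be, 0)) +
    be *: hY (hmul (x, y, t) (s * al, s * be, 0)) = D.
  apply/eqP; rewrite !xpair_eqE /=; apply/andP; split; last first.
    rewrite /GRing.scale /=; apply/eqP.
    have -> : al * (2 * (y + s * be)) + be * - (2 * (x + s * al)) =
      2 * (al * y - x * be) + 2 * s * (al * be) - 2 * s * (al * be) by ring.
    by rewrite ab0; ring.
  by apply/andP; split; rewrite /GRing.scale /=; apply/eqP; ring.
move=> e e0; exists 1 => // h _; rewrite incr (_ : s + h - s = h); last by ring.
by rewrite subrr normr0 mulr_ge0// ltW.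
Qed.

(** * Joining points by unit-speed curves inside a given set *)

(** By unit speed, [L] is at once the end of the parameter interval and the cc-length of the
    curve. *)
Definition joined (R : realType) (S : set (heisenberg R)) (L : R)
    (p q : heisenberg R) : Prop :=
  exists2 g, unit_path 0 L g &
    [/\ g 0 = p, g L = q & forall s, 0 <= s -> s <= L -> S (g s)].

Lemma joined_sub (R : realType) (S S' : set (heisenberg R)) (L : R)
    (p q : heisenberg R) : S `<=` S' -> joined S L p q -> joined S' L p q.
Proof.
move=> SS' [g ug [g0 gL gS]]; exists g => //; split => // s s0 sL.
exact/SS'/gS.
Qed.

Lemma joined_dcc (R : realType) (S : set (heisenberg R)) (L : R)
    (p q : heisenberg R) : joined S L p q -> (dcc p q <= L%:E)%E.
Proof. by move=> [g /dcc_unit_path + [<- <- _]]; rewrite subr0. Qed.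

(** The piece up to time [s] is itself a curve of length [s] from [p]. This keeps short curves
    inside small [dcc]-balls. *)
Lemma joined_ball (R : realType) (S : set (heisenberg R)) (L : R)
    (p q : heisenberg R) :
  joined S L p q -> joined [set x | (dcc p x <= L%:E)%E] L p q.
Proof.
move=> [g ug [g0 gL gS]]; exists g => //; split => // s s0 sL /=.
have us : unit_path 0 s g by exact: unit_path_sub ug.
rewrite -g0; apply: (le_trans (dcc_unit_path us)).
by rewrite subr0 lee_fin.
Qed.

Lemma joined_rev (R : realType) (S : set (heisenberg R)) (L : R)
    (p q : heisenberg R) : joined S L p q -> joined S L q p.
Proof.
move=> [g ug [g0 gL gS]]; exists (fun s => g (L + (-1) * s)).
  by have := unit_path_rev L ug; rewrite subrr subr0.
split.
- by rewrite mulr0 addr0.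
- by rewrite mulN1r subrr.
- by move=> s s0 sL; apply: gS; lra.
Qed.

Lemma joined_cat (R : realType) (S : set (heisenberg R)) (L1 L2 : R)
    (p q r : heisenberg R) :
  joined S L1 p q -> joined S L2 q r -> joined S (L1 + L2) p r.
Proof.
move=> [g ug [g0 gL gS]] [h uh [h0 hL hS]].
exists (fun s => if s <= L1 then g s else h (- L1 + 1 * s)).
  apply: unit_path_cat ug _; first by rewrite mul1r addNr gL h0.
  by have := unit_path_shift (- L1) uh; rewrite !opprK add0r (addrC L2).
have L10 : 0 <= L1 by case: ug.
have L20 : 0 <= L2 by case: uh.
split.
- by rewrite L10.
- case: ifP => [LL|_]; last by rewrite mul1r addKr.
  (* Here [L1 + L2] falls in the first branch, so the second curve is reduced to a point. *)
  have L2z : L2 = 0 by lra.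
  by rewrite L2z addr0 gL -h0 -hL L2z.
- move=> s s0 sL; case: (leP s L1) => sL1; first exact: gS.
  by apply: hS; lra.
Qed.

Lemma joined_segX (R : realType) (S : set (heisenberg R)) (c : R)
    (p : heisenberg R) : (forall z, S (hmul p (z, 0, 0))) ->
  joined S `|c| p (hmul p (c, 0, 0)).
Proof.
(* A sign equal to 1 also at [c] = 0, since the direction must be a unit vector even for a
   degenerate segment. *)
move=> Sl; pose sg : R := if 0 <= c then 1 else -1.
have sgc : `|c| * sg = c.
  rewrite /sg; case: ifPn => c0; first by rewrite mulr1 ger0_norm.
  by rewrite ltr0_norm ?ltNge// mulrN1 opprK.
have sg2 : sg ^+ 2 + 0 ^+ 2 = 1.
  by rewrite /sg; case: ifP => _; ring.
exists (fun s => hmul p (s * sg, s * 0, 0)).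
  by apply: unit_path_seg; rewrite ?mulr0.
split.
- by case: p {Sl} => [[x y] t]; rewrite /hmul /=; congr (_, _, _); ring.
- by rewrite sgc mulr0.
- by move=> s _ _; rewrite mulr0.
Qed.

Lemma joined_segY (R : realType) (S : set (heisenberg R)) (c : R)
    (p : heisenberg R) : (forall z, S (hmul p (0, z, 0))) ->
  joined S `|c| p (hmul p (0, c, 0)).
Proof.
move=> Sl; pose sg : R := if 0 <= c then 1 else -1.
have sgc : `|c| * sg = c.
  rewrite /sg; case: ifPn => c0; first by rewrite mulr1 ger0_norm.
  by rewrite ltr0_norm ?ltNge// mulrN1 opprK.
have sg2 : 0 ^+ 2 + sg ^+ 2 = 1.
  by rewrite /sg; case: ifP => _; ring.
exists (fun s => hmul p (s * 0, s * sg, 0)).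
  by apply: unit_path_seg; rewrite ?mul0r.
split.
- by case: p {Sl} => [[x y] t]; rewrite /hmul /=; congr (_, _, _); ring.
- by rewrite sgc mulr0.
- by move=> s _ _; rewrite mulr0.
Qed.

(** The second inequality comes from the reversed curve: reflection in the midpoint of [l, r]
    preserves the parameter interval. *)
Lemma unit_path_dcc_le (R : realType) (L l r : R) (g : R -> heisenberg R) :
  unit_path 0 L g -> 0 <= l -> l <= r -> r <= L ->
  (dcc (g l) (g r) <= (r - l)%:E)%E /\ (dcc (g r) (g l) <= (r - l)%:E)%E.
Proof.
move=> ug l0 lr rL; have ulr : unit_path l r g by exact: unit_path_sub ug.
split; first exact: dcc_unit_path.
have := dcc_unit_path (unit_path_rev (l + r) ulr).
by rewrite !mulN1r addrK (addrC l) addrK (addrC r) !addrK; congr (_ <= _)%E;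
  congr EFin; ring.
Qed.

Lemma unit_path_curve_length (R : realType) (L : R) (g : R -> heisenberg R) :
  unit_path 0 L g -> (curve_length (@dcc R) 0 L g <= L%:E)%E.
Proof.
move=> ug; apply: ge_ereal_sup => _ [r pr <-].
set x := fun i => nth 0 (0 :: r) i.
have xE i : (i < (size r).+1)%N -> x i = nth L (0 :: r) i.
  by move=> ir; apply: set_nth_default.
have xb i : (i < (size r).+1)%N -> 0 <= x i <= L.
  move=> ir; rewrite xE//; apply/andP; split.
    exact: itv_partition_nth_ge ir pr.
  exact: itv_partition_nth_le ir pr.
have xS i : (i < size r)%N -> x i <= x i.+1.
  move=> ir; have [/(pathP 0)/(_ i ir) + _] := pr.
  by rewrite /x => /ltW.
apply: (@le_trans _ _ (\sum_(0 <= i < size r) (x i.+1 - x i)%:E)%E).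
  rewrite big_nat [leRHS]big_nat; apply: lee_sum => i /andP[_ ir].
  have /andP[a _] := xb i (ltnW ir); have /andP[_ b] := xb i.+1 ir.
  exact: (unit_path_dcc_le ug a (xS i ir) b).1.
rewrite sumEFin telescope_sumr// lee_fin {2}/x/= subr0.
by have /andP[] := xb (size r) (ltnSn _).
Qed.

Lemma unit_path_curve_continuous (R : realType) (L : R) (g : R -> heisenberg R) :
  unit_path 0 L g -> curve_continuous (@dcc R) 0 L g.
Proof.
move=> ug s; rewrite in_itv/= => /andP[s0 sL] e e0; exists e => // t.
rewrite in_itv/= => /andP[t0 tL]; rewrite ltr_norml => /andP[h1 h2].
have [st|/ltW ts] := leP s t.
  apply: (le_lt_trans (unit_path_dcc_le ug s0 st tL).1).
  by rewrite lte_fin; lra.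
apply: (le_lt_trans (unit_path_dcc_le ug t0 ts sL).2).
by rewrite lte_fin; lra.
Qed.

(** * Null sets of lines *)

Definition strip (R : realType) (rho d eta : R) (phi : R -> R) : set (R * R) :=
  [set z | `|z.1 - rho| <= d /\ `|z.2 - phi z.1| <= eta].

Lemma measurable_strip (R : realType) (rho d eta : R) (phi : R -> R) :
  continuous phi -> measurable (strip rho d eta phi).
Proof.
move=> cphi.
have mphi : measurable_fun setT phi by exact: continuous_measurable_fun.
have m1 : measurable_fun setT (fun z : R * R => z.1) by exact: measurable_fst.
have m2 : measurable_fun setT (fun z : R * R => z.2) by exact: measurable_snd.
have -> : strip rho d eta phi =
    ((fun z : R * R => z.1 - rho) @^-1` `[- d, d]) `&`
    ((fun z : R * R => z.2 - phi z.1) @^-1` `[- eta, eta]).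
  by apply/seteqP; split => z /=; rewrite !in_itv/= -!ler_norml.
apply: measurableI; rewrite -[X in measurable X]setTI.
  have mf : measurable_fun setT (fun z : R * R => z.1 - rho) by exact: measurable_funB.
  by apply: mf => //; exact: measurable_itv.
have mf : measurable_fun setT (fun z : R * R => z.2 - phi z.1).
  by apply: measurable_funB => //; exact: measurableT_comp.
by apply: mf => //; exact: measurable_itv.
Qed.

Notation leb2 R := (@lebesgue_measure R \x @lebesgue_measure R)%E.

Lemma lebesgue_measure_center (R : realType) (c e : R) : 0 <= e ->
  (@lebesgue_measure R) `[c - e, c + e]%classic = (2 * e)%:E.
Proof.
move=> e0; rewrite lebesgue_measure_itv/= lte_fin.
case: ifPn => h; first by rewrite -EFinB; congr EFin; ring.
by congr EFin; rewrite -leNgt in h; lra.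
Qed.

(** By Fubini: over an interval of length [2 * d], each vertical section is an interval of length
    [2 * eta]. *)
Lemma lebesgue_strip (R : realType) (rho d eta : R) (phi : R -> R) :
  0 <= d -> 0 <= eta ->
  leb2 R (strip rho d eta phi) = (4 * d * eta)%:E.
Proof.
move=> d0 eta0; rewrite /product_measure1.
have sec x : lebesgue_measure (xsection (strip rho d eta phi) x) =
   ((2 * eta)%:E * (\1_`[(rho - d), (rho + d)] x)%:E)%E.
  rewrite indicE mem_setE; have [xr|xr] := boolP (x \in `[(rho - d)%R, (rho + d)%R]).
    rewrite mule1 -(lebesgue_measure_center (phi x) eta0); congr lebesgue_measure.
    move: xr; rewrite in_itv/= -ler_distl => xr.
    apply/seteqP; split => t.
      by move=> /xsectionP[/= _]; rewrite in_itv/= -ler_distl.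
    by rewrite /= in_itv/= -ler_distl => ?; apply/xsectionP; split.
  rewrite mule0 -(@measure0 _ _ _ (@lebesgue_measure R)); congr lebesgue_measure.
  apply/seteqP; split => // t /xsectionP[/=].
  by move: xr; rewrite in_itv/= -ler_distl => /negP.
transitivity (\int[lebesgue_measure]_x ((2 * eta)%:E * (\1_`[(rho - d), (rho + d)] x)%:E))%E.
  by apply: eq_integral => x _ /=; exact: sec.
rewrite ge0_integralZl//=; last 2 first.
- have mI : measurable_fun setT (\1_`[(rho - d), (rho + d)] : R -> R).
    exact: measurable_indic.
  exact/measurable_EFinP.
- by rewrite lee_fin mulr_ge0.
rewrite integral_indic//= setIT lebesgue_measure_center// -EFinM; congr EFin; ring.
Qed.

(** Such a strip has area [24 * d ^+ 3], which matches the cubes of diameters in the Hausdorff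
    3-measure. The half-height [6 * d ^+ 2] is the one produced by a set of [dcc]-diameter [d]. *)
Definition plane_null (R : realType) (B : set (R * R)) : Prop :=
  forall e : R, 0 < e -> exists (rho d : nat -> R) (phi : nat -> R -> R),
    [/\ forall i, continuous (phi i), forall i, 0 <= d i,
        B `<=` \bigcup_i strip (rho i) (d i) (6 * d i ^+ 2) (phi i) &
        (\sum_(0 <= i <oo) (d i ^+ 3)%:E <= e%:E)%E].

(** The strips give, for each n, a measurable superset of measure at most 1/(n+1); the intersection
    of these supersets has measure 0. *)
Lemma plane_null_negligible (R : realType) (B : set (R * R)) :
  plane_null B -> (leb2 R).-negligible B.
Proof.
move=> Bn.
have Bn' n : exists M : set (R * R),
    [/\ measurable M, B `<=` M & (leb2 R M <= n.+1%:R^-1%:E)%E].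
  have n0 : 0 < (24 * n.+1%:R)^-1 :> R by rewrite invr_gt0 mulr_gt0.
  have [rho [d [phi [cphi d0 BM sumd]]]] := Bn _ n0.
  have mst i := measurable_strip (rho i) (d i) (6 * d i ^+ 2) (cphi i).
  exists (\bigcup_i strip (rho i) (d i) (6 * d i ^+ 2) (phi i)); split => //.
    exact: bigcupT_measurable.
  apply: (@le_trans _ _ (\sum_(0 <= i <oo) leb2 R (strip (rho i) (d i) (6 * d i ^+ 2) (phi i)))%E).
    apply: measure_sigma_subadditive => //.
    exact: bigcupT_measurable.
  rewrite (_ : (\sum_(0 <= i <oo) _ = 24%:E * \sum_(0 <= i <oo) (d i ^+ 3)%:E)%E); last first.
    rewrite -nneseriesZl//; last by move=> i _; rewrite lee_fin exprn_ge0.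
    apply: eq_eseriesr => i _; rewrite lebesgue_strip//.
      by rewrite -EFinM; congr EFin; ring.
    by rewrite mulr_ge0// sqr_ge0.
  apply: (@le_trans _ _ (24%:E * (24 * n.+1%:R)^-1%:E)%E).
    by rewrite lee_pmul2l.
  by rewrite -EFinM lee_fin invfM mulrA mulfV// mul1r.
have [M HM] := choice Bn'.
exists (\bigcap_n M n); split.
- by apply: bigcapT_measurable => n; have [] := HM n.
- apply/eqP; rewrite eq_le; apply/andP; split; last exact: measure_ge0.
  apply/lee_addgt0Pr => e e0; rewrite add0e.
  have [n ne] : exists n, n.+1%:R^-1 <= e.
    near \oo => n; exists n; apply: ltW.
    by near: n; exact: near_infty_natSinv_lt (PosNum e0).
  apply: (@le_trans _ _ (leb2 R (M n))).
    apply: le_measure; rewrite ?inE.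
    + by apply: bigcapT_measurable => k; have [] := HM k.
    + by have [] := HM n.
    + by move=> z /(_ n I).
  by have [_ _ Mn] := HM n; apply: (le_trans Mn); rewrite lee_fin.
- by move=> z Bz n _; have [_ BM _] := HM n; exact: BM.
Unshelve. all: by end_near. Qed.

(** Finitely many null sets cannot cover an open square of area [m * m]. *)
Lemma square_point_off_plane_null (R : realType) (m : R) (s : seq (set (R * R))) :
  0 < m -> (forall B, B \in s -> plane_null B) ->
  exists r t : R, [/\ 0 < r < m, 0 < t < m & forall B, B \in s -> ~ B (r, t)].
Proof.
move=> m0 sn; apply: contrapT => nex.
pose U := \bigcup_(B in [set` s]) B.
have nU : (leb2 R).-negligible U.
  rewrite /U; elim: s sn {nex U} => [|B s IH] sn.
    by rewrite set_nil bigcup_set0; exact: negligible_set0.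
  suff : (leb2 R).-negligible (B `|` \bigcup_(B in [set` s]) B).
    apply: negligibleS => z [B' /=]; rewrite in_cons => /orP[/eqP ->|B's] zB'.
      by left.
    by right; exists B'.
  apply: negligibleU.
    by apply: plane_null_negligible; apply: sn; rewrite mem_head.
  by apply: IH => B' B's; apply: sn; rewrite in_cons B's orbT.
have nsq : (leb2 R).-negligible (`]0, m[%classic `*` `]0, m[%classic).
  apply: negligibleS nU => -[r t] /= [/[!in_itv]/= rm tm].
  apply: contrapT => nUrt; apply: nex; exists r, t; split => // B Bs Brt.
  by apply: nUrt; exists B.
have sq : leb2 R (`]0, m[%classic `*` `]0, m[%classic) = (m * m)%:E.
  have len : (@lebesgue_measure R) `]0, m[%classic = m%:E.
    by rewrite lebesgue_measure_itv/= lte_fin m0 -EFinD subr0.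
  have mI : measurable (`]0, m[%classic : set R) by exact: measurable_itv.
  by rewrite EFinM -len; exact: product_measure1E.
have sq0 : leb2 R (`]0, m[%classic `*` `]0, m[%classic) = 0%E.
  by apply/negligibleP => //; apply: measurableX; exact: measurable_itv.
by move: sq0; rewrite sq => -[] /eqP; rewrite mulf_eq0 orbb gt_eqF.
Qed.

(** * From a null Hausdorff 3-measure to null sets of lines *)

Lemma hausdorff_null_cover (R : realType) (A : set (heisenberg R)) (e : R) :
  hausdorff_measure (@dcc R) 3 A = 0%E -> 0 < e ->
  exists (C : nat -> set (heisenberg R)) (d : nat -> R),
    [/\ A `<=` \bigcup_i C i, forall i, 0 <= d i,
        forall i p q, C i p -> C i q -> (dcc p q <= (d i)%:E)%E &
        (\sum_(0 <= i <oo) (d i ^+ 3)%:E <= e%:E)%E].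
Proof.
move=> HA e0.
(* The scale 1 makes every diameter in the cover finite, so that it can serve as a real width. *)
have : (hausdorff_premeasure (@dcc R) 3 1 A < e%:E)%E.
  apply: (@le_lt_trans _ _ 0%E); last by rewrite lte_fin.
  by rewrite -HA; apply: ereal_sup_ubound; exists 1 => //=; exact: ltr01.
move=> /ereal_inf_lt[_ [C [AC diamC] <-] sumC].
have diam0 i : (0 <= diameter (@dcc R) (C i))%E.
  by apply: ereal_sup_ubound; left.
have diamE i : diameter (@dcc R) (C i) = (fine (diameter (@dcc R) (C i)))%:E.
  rewrite fineK// ge0_fin_numE//; apply: le_lt_trans (diamC i) _.
  exact: ltry.
exists C, (fun i => fine (diameter (@dcc R) (C i))); split => //.
- by move=> i; rewrite fine_ge0.
- move=> i p q Cp Cq; rewrite -diamE; apply: ereal_sup_ubound; right.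
  by exists p, q.
apply: le_trans (ltW sumC); apply: lee_nneseries.
  by move=> i _ _; rewrite lee_fin exprn_ge0// fine_ge0.
move=> i _; rewrite [in leRHS]diamE poweR_EFin (powR_mulrn 3)//.
by rewrite fine_ge0.
Qed.

(** Each cover set gets a base point [p] in it. If the witness [q] of [z] lies in the cover set
    [C i], then [q] is within [d i] of its base point, and [z] falls into the strip attached to that
    point. *)
Lemma plane_null_of_strips (R : realType) (A : set (heisenberg R))
    (B : set (R * R)) (rho : heisenberg R -> R) (phi : heisenberg R -> R -> R) :
  hausdorff_measure (@dcc R) 3 A = 0%E ->
  (forall p, continuous (phi p)) ->
  (forall z, B z -> exists2 q, A q & forall p d, (dcc p q <= d%:E)%E ->
     strip (rho p) d (6 * d ^+ 2) (phi p) z) ->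
  plane_null B.
Proof.
move=> HA cphi HB e e0.
have [C [d [AC d0 dC sumd]]] := hausdorff_null_cover HA e0.
have base i : exists p, forall q, C i q -> C i p.
  have [[p Cp]|nC] := pselect (exists p, C i p); first by exists p.
  (* An empty cover set receives the dummy base point 0. *)
  by exists 0 => q Cq; exfalso; apply: nC; exists q.
have [p Cp] := choice base.
exists (fun i => rho (p i)), d, (fun i => phi (p i)); split => //.
move=> z /HB[q Aq Hq]; have [i _ Cq] := AC q Aq; exists i => //.
by apply: Hq; apply: dC => //; exact: Cp Cq.
Qed.

(** The constant is 6 = 4 + 2: the bound on [vert] plus a cross term of modulus at most
    [2 * d ^+ 2]. *)
Lemma strip_bound (R : realType) (d k x y X Y : R) : `|k| = 2 -> `|x| <= d -> `|y| <= d ->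
  `|X| <= 4 * d ^+ 2 -> Y = X + k * (x * y) -> `|Y| <= 6 * d ^+ 2.
Proof.
move=> k2 hx hy hX ->; apply: (le_trans (ler_normD _ _)).
have : `|x * y| <= d ^+ 2 by rewrite normrM expr2 ler_pM.
rewrite [`|k * _|]normrM k2; nra.
Qed.

Lemma quadratic_continuous (R : realType) (f : R -> R) (c2 c1 c0 : R) :
  (forall r, f r = c2 * r ^+ 2 + c1 * r + c0) -> continuous f.
Proof.
move=> fE; have -> : f = (fun r => (c2%:P * 'X^2 + c1%:P * 'X + c0%:P).[r]).
  by apply/funext => r; rewrite fE !hornerE.
exact: continuous_horner.
Qed.

(** [phi] results from eliminating the line parameter [s]. For a point q = (x', y', t') of the line
    and a base point p = (x, y, v), the difference [t - phi p r] equals [vert p q] - 2(x' - x)(y' -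
    y), from which [s] cancels, while the horizontal offset in the strip is y' - y. *)
Lemma plane_null_linesX (R : realType) (A : set (heisenberg R))
    (u w : heisenberg R) :
  hausdorff_measure (@dcc R) 3 A = 0%E ->
  plane_null [set z | exists s,
    A (hmul (hmul (u + ((z.1, z.1, z.2) : heisenberg R)) w) (s, 0, 0))].
Proof.
case: u => [[xu yu] tu]; case: w => [[a b] c] HA.
pose phi (p : heisenberg R) (r : R) : R :=
  p.2 - (tu + c + 2 * (a * (yu + r) - (xu + r) * b))
  + 2 * (xu + r + a) * (yu + r + b)
  - 2 * p.1.1 * (yu + r + b) - 2 * p.1.1 * (yu + r + b - p.1.2).
apply: (@plane_null_of_strips _ A _ (fun p => p.1.2 - yu - b) phi HA).
  move=> p; apply: (@quadratic_continuous _ _ 2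
    (2 * (xu + a + yu + b) - 4 * p.1.1 - 2 * (a - b)) (phi p 0)) => r.
  rewrite /phi; ring.
move=> [r t] /= [s As]; eexists; first exact: As.
move=> [[x y] v] d /dcc_bounds[]; rewrite /vert /= => hx hy hv.
split => /=; first by rewrite (_ : r - _ = yu + r + b + 0 - y)//; ring.
by apply: (@strip_bound _ _ (-2) _ _ _ _ _ hx hy hv); rewrite ?normrN ?ger0_norm// /phi /=; ring.
Qed.

(** Here [t - phi p r] equals [vert p q] + 2(x' - x)(y' - y), again free of [s], and the horizontal
    offset in the strip is x' - x. *)
Lemma plane_null_linesY (R : realType) (A : set (heisenberg R))
    (u w : heisenberg R) :
  hausdorff_measure (@dcc R) 3 A = 0%E ->
  plane_null [set z | exists s,
    A (hmul (hmul (u + ((z.1, z.1, z.2) : heisenberg R)) w) (0, s, 0))].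
Proof.
case: u => [[xu yu] tu]; case: w => [[a b] c] HA.
pose phi (p : heisenberg R) (r : R) : R :=
  p.2 - (tu + c + 2 * (a * (yu + r) - (xu + r) * b))
  - 2 * (xu + r + a) * (yu + r + b)
  + 2 * (xu + r + a) * p.1.2 - 2 * p.1.2 * (p.1.1 - (xu + r + a)).
apply: (@plane_null_of_strips _ A _ (fun p => p.1.1 - xu - a) phi HA).
  move=> p; apply: (@quadratic_continuous _ _ (-2)
    (- (2 * (xu + a + yu + b)) + 4 * p.1.2 - 2 * (a - b)) (phi p 0)) => r.
  rewrite /phi; ring.
move=> [r t] /= [s As]; eexists; first exact: As.
move=> [[x y] v] d /dcc_bounds[]; rewrite /vert /= => hx hy hv.
split => /=; first by rewrite (_ : r - _ = xu + r + a + 0 - x)//; ring.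
by apply: (@strip_bound _ _ 2 _ _ _ _ _ hx hy hv); rewrite ?ger0_norm// /phi /=; ring.
Qed.

(** * Horizontal words *)

Lemma hmulA (R : realType) (p q r : heisenberg R) :
  hmul (hmul p q) r = hmul p (hmul q r).
Proof.
case: p => [[? ?] ?]; case: q => [[? ?] ?]; case: r => [[? ?] ?].
by rewrite /hmul /=; congr (_, _, _); ring.
Qed.

(* The word [X^a Y^b X^s Y^sg X^-s Y^-sg]. *)
Lemma joined_word (R : realType) (S : set (heisenberg R)) (p : heisenberg R)
    (a b s sg : R) :
  let w1 := (a, 0, 0) in let w2 := hmul w1 (0, b, 0) in
  let w3 := hmul w2 (s, 0, 0) in let w4 := hmul w3 (0, sg, 0) in
  let w5 := hmul w4 (- s, 0, 0) in
  (forall z, S (hmul (hmul p (0, 0, 0)) (z, 0, 0))) ->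
  (forall z, S (hmul (hmul p w1) (0, z, 0))) ->
  (forall z, S (hmul (hmul p w2) (z, 0, 0))) ->
  (forall z, S (hmul (hmul p w3) (0, z, 0))) ->
  (forall z, S (hmul (hmul p w4) (z, 0, 0))) ->
  (forall z, S (hmul (hmul p w5) (0, z, 0))) ->
  joined S (`|a| + `|b| + 2 * (`|s| + `|sg|)) p
    (hmul p (a, b, - (2 * a * b) - 4 * s * sg)).
Proof.
move=> w1 w2 w3 w4 w5 S0 S1 S2 S3 S4 S5.
(* The first condition is written with the neutral element so that all six lines pass through right
   translates of [p]. *)
have p0 : hmul p (0, 0, 0) = p.
  by case: p {S0 S1 S2 S3 S4 S5} => [[? ?] ?]; rewrite /hmul; congr (_, _, _); ring.
have J1 := joined_segX a S0; have J2 := joined_segY b S1.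
have J3 := joined_segX s S2; have J4 := joined_segY sg S3.
have J5 := joined_segX (- s) S4; have J6 := joined_segY (- sg) S5.
rewrite p0 in J1; rewrite hmulA in J2; rewrite hmulA in J3; rewrite hmulA in J4.
rewrite hmulA in J5; rewrite hmulA in J6.
have J := joined_cat (joined_cat (joined_cat (joined_cat (joined_cat J1 J2) J3) J4) J5) J6.
have -> : (a, b, - (2 * a * b) - 4 * s * sg) = hmul w5 (0, - sg, 0).
  by rewrite /w5 /w4 /w3 /w2 /w1 /hmul /=; congr (_, _, _); ring.
by rewrite !normrN in J; rewrite (_ : _ + _ = `|a| + `|b| + `|s| + `|sg| + `|s| + `|sg|)//; ring.
Qed.

(** The part [X^a Y^b] of the word already moves the last coordinate by -2ab, so its commutator must
    supply [vert p q] + 2ab. The last term is the length of that commutator. *)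
Definition word_length (R : realType) (p q : heisenberg R) : R :=
  `|q.1.1 - p.1.1| + `|q.1.2 - p.1.2| +
  2 * Num.sqrt `|vert p q + 2 * (q.1.1 - p.1.1) * (q.1.2 - p.1.2)|.

Lemma word_parameters (R : realType) (p q : heisenberg R) : exists s sg : R,
  let a := q.1.1 - p.1.1 in let b := q.1.2 - p.1.2 in
  hmul p (a, b, - (2 * a * b) - 4 * s * sg) = q /\
  `|a| + `|b| + 2 * (`|s| + `|sg|) = word_length p q.
Proof.
set m := vert p q + 2 * (q.1.1 - p.1.1) * (q.1.2 - p.1.2).
pose h := Num.sqrt `|m| / 2.
have h0 : 0 <= h by rewrite divr_ge0// sqrtr_ge0.
have hh : 4 * h * h = `|m|.
  have := sqr_sqrtr (normr_ge0 m); rewrite expr2 => <-.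
  by rewrite /h; field.
(* The commutator contributes [- 4 * s * sg], hence the sign opposite to that of [m]. *)
pose e : R := if 0 <= m then -1 else 1.
have em : - (e * `|m|) = m.
  rewrite /e; case: ifPn => m0; first by rewrite mulN1r opprK ger0_norm.
  by rewrite mul1r ltr0_norm ?opprK// ltNge.
exists h, (e * h); split.
  have -> : - (2 * (q.1.1 - p.1.1) * (q.1.2 - p.1.2)) - 4 * h * (e * h) = vert p q.
    have -> : 4 * h * (e * h) = e * (4 * h * h) by ring.
    by rewrite hh em /m; ring.
  case: p {m h h0 hh e em} => [[x y] t]; case: q => [[x' y'] t'].
  by rewrite /hmul /vert /=; congr (_, _, _); ring.
have e1 : `|e| = 1 by rewrite /e; case: ifP => _; rewrite ?normrN1 ?normr1.
rewrite [`|e * h|]normrM e1 mul1r (ger0_norm h0) /word_length -/m; congr (_ + _).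
by rewrite /h; field.
Qed.

Lemma joined_word_length (R : realType) (p q : heisenberg R) :
  joined setT (word_length p q) p q.
Proof.
have [s [sg [/= wq wL]]] := word_parameters p q.
by rewrite -wL -[X in joined _ _ _ X]wq; exact: joined_word.
Qed.

Lemma word_length_le_dcc (R : realType) (p q : heisenberg R) (d : R) :
  (dcc p q <= d%:E)%E -> word_length p q <= 7 * d.
Proof.
move=> /dcc_bounds[hx hy hv].
have d0 : 0 <= d := le_trans (normr_ge0 _) hx.
(* The quantity under the root is at most 4d^2 + 2d^2 = 6d^2, below (5d/2)^2; the total is then d +
   d + 5d = 7d. *)
suff : Num.sqrt `|vert p q + 2 * (q.1.1 - p.1.1) * (q.1.2 - p.1.2)| <= 5 / 2 * d.
  by rewrite /word_length; lra.
rewrite -[leRHS]ger0_norm ?mulr_ge0// -[leRHS]sqrtr_sqr ler_sqrt ?sqr_ge0//.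
apply: (le_trans (ler_normD _ _)).
have : `|2 * (q.1.1 - p.1.1) * (q.1.2 - p.1.2)| <= 2 * d * d.
  by rewrite !normrM (ger0_norm (_ : 0 <= 2))// ler_pM ?mulr_ge0// ler_wpM2l.
by have := sqr_ge0 d; nra.
Qed.

(** Word length grows at most like the square root of [h]. This makes the connections from the
    endpoints to their perturbations short. *)
Lemma word_length_small (R : realType) (K e : R) : 0 <= K -> 0 < e ->
  exists2 m : R, 0 < m & forall (p q : heisenberg R) (h : R), 0 <= h -> h <= m ->
    `|q.1.1 - p.1.1| <= h -> `|q.1.2 - p.1.2| <= h -> `|vert p q| <= K * h ->
    word_length p q <= e.
Proof.
move=> K0 e0; have K2 : 0 < K + 2 by rewrite ltr_wpDl.
have e4 : 0 < e / 4 by rewrite divr_gt0.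
(* Each horizontal term gets [e / 4] and the doubled root gets [e / 2]; for h <= 1 the quantity
   under the root is at most [(K + 2) * h]. *)
exists (Num.min 1 (Num.min (e / 4) ((e / 4) ^+ 2 / (K + 2)))).
  by rewrite !lt_min ltr01 e4 divr_gt0// exprn_gt0.
move=> p q h h0; rewrite !le_min => /and3P[h1 he hK] hx hy hv.
rewrite ler_pdivlMr// in hK.
suff : Num.sqrt `|vert p q + 2 * (q.1.1 - p.1.1) * (q.1.2 - p.1.2)| <= e / 4.
  by rewrite /word_length; lra.
rewrite -[leRHS]ger0_norm ?(ltW e4)// -[leRHS]sqrtr_sqr ler_sqrt ?sqr_ge0//.
apply: (le_trans _ hK); apply: (le_trans (ler_normD _ _)).
have : `|2 * (q.1.1 - p.1.1) * (q.1.2 - p.1.2)| <= 2 * h * h.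
  by rewrite !normrM (ger0_norm (_ : 0 <= 2))// ler_pM ?mulr_ge0// ler_wpM2l.
nra.
Qed.

(** * Joining points off a closed null set *)

Lemma dcc_ge0 (R : realType) (p q : heisenberg R) : (0 <= dcc p q)%E.
Proof.
apply: le_ereal_inf_tmp => _ [t0 [t1 [g [a [b [_ _ _ _ ->]]]]]].
by apply: integral_ge0 => s _; rewrite lee_fin sqrtr_ge0.
Qed.

(** A [dcc]-ball of radius [e] <= 1 about [u] lies in the sup-norm ball of radius [e * K]: in the
    last coordinate, [vert] costs 4e^2 <= 4e, and passing from [vert] to the plain difference costs
    2e times the moduli of the first two coordinates of [u]. *)
Lemma closed_avoid_dcc_ball (R : realType) (A : set (heisenberg R))
    (u : heisenberg R) : closed A -> ~ A u ->
  exists2 e : R, 0 < e & forall q, (dcc u q <= e%:E)%E -> ~ A q.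
Proof.
move=> cA nAu.
have /nbhs_ballP[rho /= rho0 sub] : nbhs u (~` A).
  by apply: open_nbhs_nbhs; split => //; exact: closed_openC.
pose K := 5 + 2 * (`|u.1.1| + `|u.1.2|).
have K0 : 0 < K by rewrite /K ltr_wpDr// mulr_ge0// addr_ge0.
have r2K : 0 < rho / 2 / K by rewrite !divr_gt0.
exists (Num.min 1 (rho / 2 / K)); first by rewrite lt_min ltr01.
set e := Num.min _ _.
have e1 : e <= 1 by rewrite ge_min lexx.
have eK : e * K <= rho / 2 by rewrite -ler_pdivlMr// ge_min lexx orbT.
move=> q /dcc_bounds[hx hy hv]; apply: sub.
have e0 : 0 <= e := le_trans (normr_ge0 _) hx.
rewrite -ball_normE /= distrC; apply: (@le_lt_trans _ _ (e * K)); last by lra.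
have K1 : 1 <= K.
  by have := normr_ge0 u.1.1; have := normr_ge0 u.1.2; rewrite /K; lra.
rewrite !prod_normE /= !ge_max -andbA; apply/and3P; split.
- by apply: (le_trans hx); rewrite ler_peMr.
- by apply: (le_trans hy); rewrite ler_peMr.
have -> : q.2 - u.2 = vert u q - 2 * u.1.1 * (q.1.2 - u.1.2) + 2 * u.1.2 * (q.1.1 - u.1.1).
  by rewrite /vert; ring.
apply: (le_trans (ler_normD _ _)).
have B1 : `|2 * u.1.2 * (q.1.1 - u.1.1)| <= 2 * `|u.1.2| * e.
  by rewrite !normrM (ger0_norm (_ : 0 <= 2))// ler_wpM2l ?mulr_ge0.
have B2 : `|2 * u.1.1 * (q.1.2 - u.1.2)| <= 2 * `|u.1.1| * e.
  by rewrite !normrM (ger0_norm (_ : 0 <= 2))// ler_wpM2l ?mulr_ge0.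
have B3 := ler_normB (vert u q) (2 * u.1.1 * (q.1.2 - u.1.2)).
rewrite /K; nra.
Qed.

Lemma joined_quasiconvex (R : realType) (Z : set (heisenberg R)) (c : R) :
  1 <= c ->
  (forall u v, Z u -> Z v -> exists L D : R,
     [/\ joined Z L u v, dcc u v = D%:E & L <= c * D]) ->
  quasiconvex (@dcc R) Z.
Proof.
move=> c1 H; exists c => // u v Zu Zv.
have [L [D [[g ug [g0 gL gZ]] uvD LD]]] := H u v Zu Zv.
have len := unit_path_curve_length ug.
exists 0, L, g; split => //; first by case: ug.
split.
- by move=> t; rewrite in_itv/= => /andP[]; exact: gZ.
- exact: unit_path_curve_continuous.
- exact: le_lt_trans len (ltry _).
- by apply: (le_trans len); rewrite uvD -EFinM lee_fin.
Qed.

Lemma joined_avoid (R : realType) (A : set (heisenberg R)) (u v : heisenberg R)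
    (e : R) : (forall q, (dcc u q <= e%:E)%E -> ~ A q) -> word_length u v <= e ->
  joined (~` A) (word_length u v) u v.
Proof.
move=> HA uve; apply: joined_sub (joined_ball (joined_word_length u v)).
by move=> q /= uq; apply: HA; apply: (le_trans uq); rewrite lee_fin.
Qed.

(* Perturbing [u] in the direction [(r, r, t)] moves both horizontal lines
   through any right translate of [u] transversally. *)
Lemma generic_word (R : realType) (A : set (heisenberg R)) (u w : heisenberg R)
    (a b s sg m : R) :
  hausdorff_measure (@dcc R) 3 A = 0%E -> 0 < m ->
  w = (a, b, - (2 * a * b) - 4 * s * sg) ->
  exists r t : R, [/\ 0 < r < m, 0 < t < m &
    let u' : heisenberg R := u + ((r, r, t) : heisenberg R) in
    joined (~` A) (`|a| + `|b| + 2 * (`|s| + `|sg|)) u' (hmul u' w)].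
Proof.
move=> HA m0 ->.
pose w1 : heisenberg R := (a, 0, 0); pose w2 := hmul w1 (0, b, 0).
pose w3 := hmul w2 (s, 0, 0); pose w4 := hmul w3 (0, sg, 0).
pose w5 := hmul w4 (- s, 0, 0).
pose BX w := [set z : R * R | exists s,
  A (hmul (hmul (u + ((z.1, z.1, z.2) : heisenberg R)) w) (s, 0, 0))].
pose BY w := [set z : R * R | exists s,
  A (hmul (hmul (u + ((z.1, z.1, z.2) : heisenberg R)) w) (0, s, 0))].
(* One exceptional set for each of the six lines carrying the word. *)
have [|r [t [rm tm H]]] := @square_point_off_plane_null R m
    [:: BX (0, 0, 0); BY w1; BX w2; BY w3; BX w4; BY w5] m0.
  have nX w' : plane_null (BX w') by exact: plane_null_linesX.
  have nY w' : plane_null (BY w') by exact: plane_null_linesY.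
  move=> B; rewrite !inE.
  by move=> /or3P[/eqP ->|/eqP ->|/or4P[]/eqP ->].
exists r, t; split => //=; apply: joined_word => z Az.
- by apply: (H (BX (0, 0, 0))); [rewrite !inE eqxx|exists z].
- by apply: (H (BY w1)); [rewrite !inE eqxx ?orbT|exists z].
- by apply: (H (BX w2)); [rewrite !inE eqxx ?orbT|exists z].
- by apply: (H (BY w3)); [rewrite !inE eqxx ?orbT|exists z].
- by apply: (H (BX w4)); [rewrite !inE eqxx ?orbT|exists z].
- by apply: (H (BY w5)); [rewrite !inE eqxx ?orbT|exists z].
Qed.

(** Measures how far the end of the word drifts when its start is perturbed. For fixed [u] and [w]
    the drift is linear in [r] and [t], as [word_length_small] requires. *)
Lemma hmul_perturb (R : realType) (u w : heisenberg R) (r t : R) :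
  let u' : heisenberg R := u + ((r, r, t) : heisenberg R) in
  [/\ (hmul u' w).1.1 - (hmul u w).1.1 = r, (hmul u' w).1.2 - (hmul u w).1.2 = r &
    vert (hmul u w) (hmul u' w) =
    t + 2 * r * (w.1.1 - w.1.2) + 2 * r * ((hmul u w).1.1 - (hmul u w).1.2)].
Proof.
case: u => [[x y] z]; case: w => [[a b] c] u'.
by rewrite /vert /u' /=; split; ring.
Qed.

Theorem corollary1p2 (R : realType) (A : set (heisenberg R)) :
  closed A ->
  hausdorff_measure (@dcc R) 3 A = 0%E ->
  quasiconvex (@dcc R) (~` A).
Proof.
(* 8 = 7 + 1/2 + 1/2: the word and the two connections near the endpoints. *)
move=> cA HA; apply: (@joined_quasiconvex R _ 8); first by rewrite ler1n.
move=> u v nAu nAv.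
pose D := fine (dcc u v).
(* Finiteness holds because some word joins [u] to [v] in the whole space. *)
have uvD : dcc u v = D%:E.
  rewrite /D fineK// ge0_fin_numE ?dcc_ge0//.
  exact: le_lt_trans (joined_dcc (joined_word_length u v)) (ltry _).
have uv7 : word_length u v <= 7 * D by apply: word_length_le_dcc; rewrite uvD.
have [hx hy hv] : [/\ `|v.1.1 - u.1.1| <= D, `|v.1.2 - u.1.2| <= D &
    `|vert u v| <= 4 * D ^+ 2] by apply: dcc_bounds; rewrite uvD.
have D0 : 0 <= D := le_trans (normr_ge0 _) hx.
(* If [D] = 0 there is no room for a perturbation, but the word itself has length 0 and stays at
   distance 0 from [u]. *)
have [Dz|Dn0] := eqVneq D 0.
  have uv : word_length u v = 0.
    apply/eqP; rewrite eq_le; apply/andP; split.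
      by apply: (le_trans uv7); rewrite Dz mulr0.
    by rewrite /word_length !addr_ge0 ?mulr_ge0 ?sqrtr_ge0.
  have [e e0 eA] := closed_avoid_dcc_ball cA nAu.
  exists (word_length u v), D; split => //; last by rewrite uv Dz mulr0.
  by apply: (joined_avoid eA); rewrite uv ltW.
have Dp : 0 < D by rewrite lt_neqAle eq_sym Dn0.
have [eu eu0 euA] := closed_avoid_dcc_ball cA nAu.
have [ev ev0 evA] := closed_avoid_dcc_ball cA nAv.
(* The bound [D / 2] makes the two connections cost at most [D] together; [eu] and [ev] keep them in
   the balls that avoid [A]. *)
pose e := Num.min (D / 2) (Num.min eu ev).
have e0 : 0 < e by rewrite !lt_min eu0 ev0 divr_gt0.
have eD : e <= D / 2 by rewrite ge_min lexx.
have eeu : e <= eu by rewrite !ge_min lexx !orbT.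
have eev : e <= ev by rewrite !ge_min lexx !orbT.
have [s [sg []]] := word_parameters u v.
set a := v.1.1 - u.1.1; set b := v.1.2 - u.1.2; set w := (a, b, _) => uwv wL.
(* Collects the coefficients of the vertical displacements at both ends: 1 for [t], the others for
   the terms [2 * r * x] of [hmul_perturb]. *)
pose K := 1 + 2 * `|u.1.1 - u.1.2| + 2 * `|a - b| + 2 * `|v.1.1 - v.1.2|.
have K0 : 0 <= K by rewrite !addr_ge0 ?mulr_ge0.
have [m m0 Hm] := word_length_small K0 e0.
have [r [t [/andP[r0 rm] /andP[t0 tm]]]] := generic_word u HA m0 (erefl w).
set u' : heisenberg R := u + _; rewrite /= wL => Juv.
pose h := Num.max r t.
have rh : r <= h by rewrite le_max lexx.
have th : t <= h by rewrite le_max lexx orbT.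
have h0 : 0 <= h by rewrite (le_trans (ltW r0)).
have hm : h <= m by rewrite ge_max !ltW.
have bnd x : `|2 * r * x| <= 2 * `|x| * h.
  by rewrite !normrM (ger0_norm (_ : 0 <= 2))// (ger0_norm (ltW r0)) mulrAC
    ler_wpM2l// mulr_ge0.
have u0 : hmul u (0, 0, 0) = u.
  by case: (u) => [[? ?] ?]; rewrite /hmul; congr (_, _, _); ring.
have u'0 : hmul u' (0, 0, 0) = u'.
  by case: (u') => [[? ?] ?]; rewrite /hmul; congr (_, _, _); ring.
(* The start of the word is treated as the end of the trivial word, so [hmul_perturb] applies with
   the neutral element. *)
have wu : word_length u u' <= e.
  have [] := hmul_perturb u (0, 0, 0) r t.
  rewrite -/u' u0 u'0 (subrr (0 : R)) mulr0 addr0 => dx dy dv; apply: (Hm _ _ h) => //.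
  - by rewrite dx ger0_norm// ltW.
  - by rewrite dy ger0_norm// ltW.
  rewrite dv; apply: (le_trans (ler_normD _ _)); rewrite ger0_norm ?(ltW t0)//.
  have := bnd (u.1.1 - u.1.2).
  have := mulr_ge0 (normr_ge0 (a - b)) h0.
  have := mulr_ge0 (normr_ge0 (v.1.1 - v.1.2)) h0.
  by rewrite /K; lra.
have wv : word_length v (hmul u' w) <= e.
  have [] := hmul_perturb u w r t; rewrite -/u' uwv => dx dy dv; apply: (Hm _ _ h) => //.
  - by rewrite dx ger0_norm// ltW.
  - by rewrite dy ger0_norm// ltW.
  rewrite dv; apply: (le_trans (ler_normD _ _)).
  apply: (le_trans (lerD (ler_normD _ _) (lexx _))); rewrite (ger0_norm (ltW t0)).
  have := bnd (a - b); have := bnd (v.1.1 - v.1.2).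
  have := mulr_ge0 (normr_ge0 (u.1.1 - u.1.2)) h0.
  by rewrite /K; lra.
have Ju := joined_avoid euA (le_trans wu eeu).
have Jv := joined_avoid evA (le_trans wv eev).
have J := joined_cat (joined_cat Ju Juv) (joined_rev Jv).
exists (word_length u u' + word_length u v + word_length v (hmul u' w)), D.
by split => //; lra.
Qed.
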